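(* For every finite-dimensional real normed spaces $F$ and $G$, every $r\in\mathbb{N}$ and every $\varepsilon>0$ there is a finite-dimensional normed space $H$ such that $F$ isometrically embeds into $H$ and every $r$-coloring of $\mathrm{Emb}(F,H)$ has an $\varepsilon$-monochromatic set of the form $\gamma\circ\mathrm{Emb}(F,G)$ for some $\gamma\in\mathrm{Emb}(G,H)$. In fact, $H$ can be found such that $$\dim H\le(\dim F)^{\left(1+\frac{8(5+\varepsilon)}{\varepsilon}\right)^{n\cdot\dim F}}\cdot(\dim G)^{\left(1+\frac{8(5+\varepsilon)}{\varepsilon}\right)^{n\cdot\dim G}}\cdot n,$$ where $$n=\mathbf{n}_{\mathrm{pol}}\Big(\Big\lfloor\Big(\tfrac{10+3\varepsilon}{\varepsilon}\Big)^{\dim F}\Big\rfloor,\ \Big\lfloor\Big(\tfrac{10+3\varepsilon}{\varepsilon}\Big)^{\dim G}+\Big(\tfrac{10+3\varepsilon}{\varepsilon}\Big)^{\dim F}\Big(1+\tfrac{8(5+\varepsilon)}{\varepsilon}\Big)^{\dim F\cdot\dim G}\Big\rfloor,\ r,\ \tfrac{\varepsilon}{4}\Big).$$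
   Context: $\mathrm{Emb}(X,Y)$ is the set of linear isometric embeddings $X\to Y$ with the operator-norm metric. An $r$-coloring is a map into $\{0,\dots,r-1\}$; a subset $S$ of the colored space $M$ is $\varepsilon$-monochromatic if for some color $i$ every element of $S$ is within distance $\varepsilon$ of an element of $M$ of color $i$. A finite-dimensional normed space is polyhedral if its unit ball has finitely many extreme points; $\mathrm{Pol}_d$ is the class of polyhedral spaces whose dual unit ball has exactly $2d$ extreme points. $\mathbf{n}_{\mathrm{pol}}(d,m,r,\varepsilon)$ is the least $n\ge m$ such that for all $F'\in\mathrm{Pol}_d$ and $G'\in\mathrm{Pol}_m$, every $r$-coloring of $\mathrm{Emb}(F',\ell_\infty^n)$ has an $\varepsilon$-monochromatic set $T\circ\mathrm{Emb}(F',G')$ for some $T\in\mathrm{Emb}(G',\ell_\infty^n)$. *)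

(* Defs.v *)
From HB Require Import structures.
From mathcomp Require Import all_boot all_order all_algebra.
From mathcomp Require Import all_classical all_reals all_analysis.
Set Implicit Arguments. Unset Strict Implicit. Unset Printing Implicit Defensive.
Import Order.TTheory GRing.Theory Num.Theory.
Local Open Scope classical_set_scope.
Local Open Scope ring_scope.

(* A finite-dimensional real normed space of dimension k is represented
   (up to linear isometry) as R^k = 'rV[R]_k equipped with a norm N.
   Linear maps R^k -> R^l are matrices 'M_(k,l) acting on row vectors. *)
Section Defs.
Variable R : realType.

Definition is_norm (k : nat) (N : 'rV[R]_k -> R) : Prop :=
  [/\ forall x, N x = 0 -> x = 0,
      forall (a : R) x, N (a *: x) = `|a| * N x
    & forall x y, N (x + y) <= N x + N y].

Definition isEmb (k l : nat) (NX : 'rV[R]_k -> R) (NY : 'rV[R]_l -> R)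
  (A : 'M[R]_(k, l)) : Prop := forall x, NY (x *m A) = NX x.

Definition Emb (k l : nat) (NX : 'rV[R]_k -> R) (NY : 'rV[R]_l -> R)
  : set 'M[R]_(k, l) := [set A | isEmb NX NY A].

Definition opnorm (k l : nat) (NX : 'rV[R]_k -> R) (NY : 'rV[R]_l -> R)
  (A : 'M[R]_(k, l)) : R :=
  sup [set NY (x *m A) | x in [set x | NX x <= 1]].

Definition opdist (k l : nat) (NX : 'rV[R]_k -> R) (NY : 'rV[R]_l -> R)
  (A B : 'M[R]_(k, l)) : R := opnorm NX NY (A - B).

Definition eps_mono (k l r : nat) (NX : 'rV[R]_k -> R) (NY : 'rV[R]_l -> R)
  (c : 'M[R]_(k, l) -> 'I_r) (eps : R) (S : set 'M[R]_(k, l)) : Prop :=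
  exists i : 'I_r, forall A, S A ->
    exists B, Emb NX NY B /\ c B = i /\ opdist NX NY A B <= eps.

Definition ramsey_prop (k m l r : nat) (NX : 'rV[R]_k -> R)
  (NZ : 'rV[R]_m -> R) (NY : 'rV[R]_l -> R) (eps : R) : Prop :=
  forall c : 'M[R]_(k, l) -> 'I_r,
    exists T : 'M[R]_(m, l), Emb NZ NY T /\
      eps_mono NX NY c eps [set A *m T | A in Emb NX NZ].

Definition linf (n : nat) (x : 'rV[R]_n) : R :=
  \big[Num.max/0]_(i < n) `|x 0 i|.

Definition dualnorm (k : nat) (N : 'rV[R]_k -> R) (f : 'rV[R]_k) : R :=
  sup [set \sum_(i < k) x 0 i * f 0 i | x in [set x | N x <= 1]].

Definition ball1 (k : nat) (N : 'rV[R]_k -> R) : set 'rV[R]_k :=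
  [set x | N x <= 1].

Definition extreme_point (k : nat) (B : set 'rV[R]_k) (x : 'rV[R]_k) : Prop :=
  B x /\ forall y z (t : R), B y -> B z -> 0 < t -> t < 1 ->
    x = t *: y + (1 - t) *: z -> y = z.

Definition polyhedral (k : nat) (N : 'rV[R]_k -> R) : Prop :=
  exists s : seq 'rV[R]_k, forall x, extreme_point (ball1 N) x -> x \in s.

Definition in_Pol (d k : nat) (N : 'rV[R]_k -> R) : Prop :=
  [/\ is_norm N, polyhedral N &
    exists s : seq 'rV[R]_k, [/\ uniq s, size s = (2 * d)%N &
      forall f, extreme_point (ball1 (dualnorm N)) f <-> f \in s]].

Definition npol_prop (d m r : nat) (eps : R) (n : nat) : Prop :=
  forall (k : nat) (NF : 'rV[R]_k -> R) (l : nat) (NG : 'rV[R]_l -> R),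
    in_Pol d NF -> in_Pol m NG -> ramsey_prop r NF NG (@linf n) eps.

Definition is_npol (d m r : nat) (eps : R) (n : nat) : Prop :=
  [/\ (m <= n)%N, npol_prop d m r eps n &
    forall n', (m <= n')%N -> npol_prop d m r eps n' -> (n <= n')%N].

End Defs.

(* Main.v *)
Require Import Defs.
From HB Require Import structures.
From mathcomp Require Import all_boot all_order all_algebra.
From mathcomp Require Import all_classical all_reals all_analysis.
From mathcomp Require Import zify ring lra.
Set Implicit Arguments. Unset Strict Implicit. Unset Printing Implicit Defensive.
Import Order.TTheory GRing.Theory Num.Theory.
Import numFieldNormedType.Exports.

(** For [F' in Pol_d] the extreme points of the dual ball, one from each pair [f, -f],
    embed [F'] into [linf^d]. An extreme point of the dual ball of [F'] extends along an
    embedding [F' -> G'] to an extreme point of the dual ball of [G'], hence that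
    embedding is the restriction of an embedding [linf^d -> linf^m]. So the existence of
    [n_pol] reduces to the Ramsey property of the spaces [linf^n], which is an instance
    of the Graham-Rothschild theorem up to rounding.

    For arbitrary [F] and [G], delta-nets of the dual spheres give almost isometric maps
    of [F] into [linf^d] and of [G] into [linf^m], and if the functionals on [G] include
    extensions of those on [F] along a net of [Emb(F, G)], then every [F -> G] is close
    to the restriction of an embedding [linf^d -> linf^m]. The space [H] arises from
    [linf^n] by amalgamating copies of [F] and [G] along nets of the almost isometric
    maps into [linf^n]. If [dim F = dim G = 1] these maps are isometric and [H] is
    [linf^n], as the bound on [dim H] requires. The net sizes [(1 + 2 / delta)^k] are
    obtained from digit expansions instead of volumes. *)

(** * The Graham-Rothschild theorem *)

(** Two obstacles shape the proof. Closeness to a color is measured by exact embeddings into [H],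
    whereas the detour through linf^d gives almost isometric maps; so [H] must contain an exact
    embedding near each of them, and a coloring of Emb(F, H) is read as one of Emb(linf^d, linf^n)
    through a choice of such embeddings. Secondly, Graham-Rothschild words introduce their
    parameters in a fixed order, which rounding could spoil; the vectors used for rounding are
    therefore listed by increasing scale, and inexact rounding always goes to an earlier entry. The
    constants are net sizes. With e = eps / (5 + eps) one has (10 + 3 eps) / eps = 1 + 2 / e and 1 +
    8 (5 + eps) / eps = 1 + 2 / (e / 4). The first argument of n_pol bounds an e-net of the dual
    sphere of F. The second bounds such a net for G together with one functional for each member of
    an (e / 4)-net of Emb(F, G) and each functional on F. The exponents n dim F and n dim G are
    dimensions of spaces of maps into linf^n, whose nets tell how many copies are amalgamated. *)

(* A word over the constants [0 .. l - 1] and the parameters [l .. l + k - 1],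
   all of which occur, their first occurrences being in increasing order. After
   its first occurrence a parameter behaves like a constant. *)
Fixpoint rigid (l k : nat) (w : seq nat) : bool :=
  if w is x :: w' then
    (x < l) && rigid l k w' ||
    [&& x == l, 0 < k & rigid l.+1 k.-1 w']
  else k == 0.

(* The composition of a word [s] having [m] parameters, over [l] constants, with a
   word [t] of length [m] is [wsubst (iota 0 l ++ t) s]. *)
Definition wsubst (t s : seq nat) : seq nat := [seq nth 0 t y | y <- s].

Lemma size_wsubst t s : size (wsubst t s) = size s.
Proof. exact: size_map. Qed.

Lemma wsubst_cons t x s : wsubst t (x :: s) = nth 0 t x :: wsubst t s.
Proof. by []. Qed.

Lemma wsubst_cat t s1 s2 : wsubst t (s1 ++ s2) = wsubst t s1 ++ wsubst t s2.
Proof. exact: map_cat. Qed.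

Lemma rigid_bound l k w : rigid l k w -> all (fun y => y < l + k) w.
Proof.
elim: w l k => //= x w IH l k /orP[/andP[xl /IH ->]|].
  by rewrite andbT (leq_trans xl) // leq_addr.
case: k => [|k] /and3P[/eqP -> //= _ /IH h]; rewrite -ltn_subLR // subnn /=.
by rewrite -addSnnS.
Qed.

Lemma wsubst_wsubst t s w : all (fun y => y < size s) w ->
  wsubst t (wsubst s w) = wsubst (wsubst t s) w.
Proof.
move=> /allP h; rewrite /wsubst -map_comp; apply/eq_in_map => y /h ys /=.
by rewrite (nth_map 0).
Qed.

(** The induction needs [pre]: at the first occurrence of a parameter of [sig] its value moves from
    [tau] to [pre], since afterwards it acts as a constant; if that value is a new letter, [l] grows
    by one. *)
Lemma rigid_wsubst pre l k tau sig : all (fun y => y < l) pre -> rigid l k tau ->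
  rigid (size pre) (size tau) sig -> rigid l k (wsubst (pre ++ tau) sig).
Proof.
elim: sig pre l k tau => [|x sig IH] pre l k tau hp ht /=.
  by move=> /eqP/size0nil ts; move: ht; rewrite ts.
move=> /orP[/andP[xp h]|].
  by rewrite nth_cat xp (all_nthP 0 hp) //= IH.
case: tau ht => [|y tau] ht; rewrite ?andbF // => /and3P[/eqP -> _ /= h].
rewrite nth_cat ltnn subnn /= -cat_rcons.
move: ht => /= /orP[/andP[yl ht]|/and3P[/eqP -> k0 ht]].
  by rewrite yl /= IH ?size_rcons // all_rcons yl.
rewrite ltnn eqxx k0 /= IH ?size_rcons //.
by rewrite all_rcons leqnn /=; apply: sub_all hp => z /ltnW.
Qed.

Lemma rigid_cat l k k' w w' : rigid l k w -> rigid (l + k) k' w' ->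
  rigid l (k + k') (w ++ w').
Proof.
elim: w l k => [|x w IH] l k /=; first by move=> /eqP ->; rewrite addn0.
move=> /orP[/andP[-> h] h'|]; first by rewrite IH.
case: k => [|k] /and3P[/eqP -> //= _ h h'].
by rewrite eqxx /= (IH _ k) ?orbT // addSnnS.
Qed.

Lemma rigid0 l w : rigid l 0 w = all (fun y => y < l) w.
Proof. by elim: w => //= x w ->; rewrite andbF orbF. Qed.

Lemma rigid1 l w : all (fun y => y <= l) w -> l \in w -> rigid l 1 w.
Proof.
elim: w => //= x w IH /andP[xl hw]; rewrite inE.
move: xl; rewrite leq_eqVlt => /orP[/eqP e _|xl].
  by rewrite e eqxx /= rigid0 (sub_all _ hw) ?orbT // => y; rewrite ltnS.
by rewrite eq_sym (ltn_eqF xl) xl /= => /IH ->.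
Qed.

Lemma rigid_mem l k w i : rigid l k w -> i < k -> l + i \in w.
Proof.
elim: w l k i => [|x w IH] l k i /=; first by move=> /eqP ->.
move=> /orP[/andP[xl h] ik|]; first by rewrite inE (IH _ k) ?orbT.
move=> /and3P[/eqP -> k0 h] ik; rewrite inE; case: i ik => [|i] ik.
  by rewrite addn0 eqxx.
by rewrite -addSnnS (IH _ k.-1) ?orbT //; lia.
Qed.

Definition line l (v : seq nat) x := wsubst (iota 0 l ++ [:: x]) v.

Lemma size_line l v x : size (line l v x) = size v.
Proof. exact: size_map. Qed.

Lemma line_cat l v w x : line l (v ++ w) x = line l v x ++ line l w x.
Proof. exact: map_cat. Qed.

Lemma iota_bound l : all (fun y => y < l) (iota 0 l).
Proof. by apply/allP => y; rewrite mem_iota. Qed.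

Lemma wsubst_id l t w : all (fun y => y < l) w -> wsubst (iota 0 l ++ t) w = w.
Proof.
move=> /allP h; rewrite -[RHS]map_id; apply/eq_in_map => y /h yl.
by rewrite nth_cat size_iota yl nth_iota.
Qed.

Lemma line_bound l v x : rigid l 1 v -> x < l -> all (fun y => y < l) (line l v x).
Proof.
move=> hv xl; rewrite -rigid0; apply: rigid_wsubst; rewrite ?size_iota //=.
  exact: iota_bound.
by rewrite xl.
Qed.

Lemma rigid_iota l m : rigid l m (iota l m).
Proof. by elim: m l => //= m IH l; rewrite eqxx ltnn /= IH. Qed.

(* Frees the letter [l] by renaming the parameters [l + i] to [l + 1 + i]. *)
Definition wshift l (w : seq nat) := map (bump l) w.

Lemma rigid_wshift l m w : rigid l m w -> rigid l.+1 m (wshift l w).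
Proof.
move=> h; have -> : wshift l w = wsubst (iota 0 l ++ iota l.+1 m) w.
  apply/eq_in_map => y /(allP (rigid_bound h)) ylm.
  rewrite nth_cat size_iota /bump; case: (ltnP y l) => yl; first by rewrite nth_iota.
  by rewrite nth_iota; lia.
apply: rigid_wsubst; rewrite ?size_iota //; last exact: rigid_iota.
by apply: sub_all (iota_bound l) => y /ltnW.
Qed.

Lemma wsubst_wshift l t x w :
  wsubst (iota 0 l ++ x :: t) (wshift l w) = wsubst (iota 0 l ++ t) w.
Proof.
rewrite /wsubst /wshift -map_comp; apply/eq_map => y /=.
rewrite !nth_cat size_iota /bump; case: (ltnP y l) => yl; first by rewrite yl.
by rewrite ltnNge leqW //= add1n subSn.
Qed.

Lemma line_wshift l v x : line l.+1 (wshift l v) x = line l v x.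
Proof.
rewrite /line -[RHS](@wsubst_wshift l [:: x] l v).
by rewrite -addn1 iotaD -catA.
Qed.

Lemma word_tuple l n (u : seq nat) : size u = n -> all (fun y => y < l) u ->
  exists t : n.-tuple 'I_l, u = map val t.
Proof.
elim: n u => [|n IH] [|x u] //=; first by exists [tuple].
by move=> [/IH h] /andP[xl /h[t ->]]; exists [tuple of Ordinal xl :: t].
Qed.

(** * The Hales-Jewett theorem and its multidimensional form *)

Definition mono_line (C : eqType) l n (c : seq nat -> C) := exists v,
  [/\ size v = n, rigid l 1 v &
   forall x y, x < l -> y < l -> c (line l v x) = c (line l v y)].

Definition HJ l := forall C : finType, exists n, forall c : seq nat -> C, mono_line l n c.

(* [veccol n l c] treats the colorings [c u], [u] a word of length [n], at once. *)
Definition veccol (C : finType) n l (c : seq nat -> seq nat -> C) :=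
  fun z => [ffun u : n.-tuple 'I_l => c (map val u) z].

Lemma veccolP (C : finType) n l (c : seq nat -> seq nat -> C) z z' u :
  veccol n l c z = veccol n l c z' -> size u = n -> all (fun y => y < l) u ->
  c u z = c u z'.
Proof.
by move=> e su /(word_tuple su)[t ->]; move/ffunP: e => /(_ t); rewrite !ffunE.
Qed.

(* Color focusing: [s] lines with the common point [w] at letter [l], each of
   them monochromatic on the letters below [l], in pairwise distinct colors. *)
Definition focused (C : eqType) l n (c : seq nat -> C) s :=
  exists (vs : seq (seq nat)) (w : seq nat),
  [/\ size vs = s, size w = n, all (fun y => y < l.+1) w,
   forall v, v \in vs -> [/\ size v = n, rigid l.+1 1 v, line l.+1 v l = w &
     forall x, x < l -> c (line l.+1 v x) = c (line l.+1 v 0)] &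
   uniq [seq c (line l.+1 v 0) | v <- vs]].

(** Induction on [s]. Hales-Jewett over [l] letters, for the colors under all prefixes of length [n]
    at once, gives a suffix line whose letter below [l] does not affect the color. Each earlier line
    is continued along it, and one new line keeps its prefix at the focus [w]; all of them meet at
    letter [l]. If the color of [w] is already present, an earlier line becomes monochromatic. *)
Lemma focusing l (C : finType) s : 0 < l -> HJ l -> exists n,
  forall c : seq nat -> C, mono_line l.+1 n c \/ focused l n c s.
Proof.
move=> l0 hj; elim: s => [|s [n IH]].
  by exists 0 => c; right; exists [::], [::]; split.
have [n' hn'] := hj ({ffun n.-tuple 'I_l.+1 -> C} : finType).
exists (n + n') => c.
have [v' [sv' rv' mv']] := hn' (veccol n l.+1 (fun u z => c (u ++ z))).
(* Over [l + 1] letters the old parameter [l] is an ordinary letter, so the parameter is renamed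
   [l + 1]. *)
pose v2 := wshift l v'.
have rv2 : rigid l.+1 1 v2 by exact: rigid_wshift.
have sv2 : size v2 = n' by rewrite size_map.
have v2E x : line l.+1 v2 x = line l v' x by exact: line_wshift.
pose c' u := c (u ++ line l v' 0).
have cE u x : size u = n -> all (fun y => y < l.+1) u -> x < l ->
    c (u ++ line l v' x) = c' u.
  by move=> su hu xl; apply: (veccolP (mv' x 0 xl l0) su hu).
have all0 : all (fun y => y < l.+1) (line l v' 0).
  by apply: sub_all (line_bound rv' l0) => y /ltnW.
have mono : mono_line l.+1 n c' -> mono_line l.+1 (n + n') c.
  move=> [v [sv rv mv]]; exists (v ++ line l v' 0); split.
  - by rewrite size_cat sv size_line sv'.
  - rewrite -[1]addn0; apply: rigid_cat => //; rewrite rigid0.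
    by apply: sub_all all0 => y yl; rewrite addn1 ltnW.
  move=> x y xl yl.
  by rewrite !line_cat ![line l.+1 (line _ _ _) _]wsubst_id //; apply: mv.
have [/mono|[vs [w [svs sw hw hvs uvs]]]] := IH c'; first by left.
have [|cw] := boolP (c' w \in [seq c' (line l.+1 v 0) | v <- vs]).
  move=> /mapP[v vin cv]; left; apply: mono; exists v.
  have [sv rv fv mv] := hvs v vin; split=> //.
  have h x : x < l.+1 -> c' (line l.+1 v x) = c' (line l.+1 v 0).
    by rewrite ltnS leq_eqVlt => /orP[/eqP ->|/mv//]; rewrite fv.
  by move=> x y /h -> /h ->.
right; pose vs' := (w ++ v2) :: [seq v ++ v2 | v <- vs].
have c0 v : v \in vs -> c (line l.+1 (v ++ v2) 0) = c' (line l.+1 v 0).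
  move=> /hvs[sv rv fv mv]; rewrite line_cat v2E cE ?size_line //.
  exact: line_bound.
have cw0 x : x < l -> c (line l.+1 (w ++ v2) x) = c' w.
  by move=> xl; rewrite line_cat v2E [line l.+1 w x]wsubst_id // cE.
exists vs', (w ++ line l.+1 v2 l); split.
- by rewrite /= size_map svs.
- by rewrite size_cat sw size_line sv2.
- by rewrite all_cat hw line_bound.
- move=> v; rewrite inE => /orP[/eqP ->|/mapP[v1 v1in ->]].
    split=> [|||x xl].
    + by rewrite size_cat sw sv2.
    + by rewrite -[1]add0n; apply: rigid_cat; rewrite ?rigid0 ?addn0.
    + by rewrite line_cat [line l.+1 w l]wsubst_id.
    + by rewrite !cw0.
  have [sv rv fv mv] := hvs v1 v1in; split=> [|||x xl].
  + by rewrite size_cat sv sv2.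
  + rewrite -[1]addn0; apply: rigid_cat => //; rewrite rigid0.
    exact: rigid_bound rv2.
  + by rewrite line_cat fv.
  + rewrite c0 // line_cat v2E cE ?size_line ?mv //.
    by apply: line_bound rv _; rewrite ltnW.
- rewrite /= cw0 // -map_comp.
  have -> : [seq ((fun v => c (line l.+1 v 0)) \o cat^~ v2) i | i <- vs] =
            [seq c' (line l.+1 v 0) | v <- vs].
    by apply/eq_in_map => v /c0.
  by rewrite cw.
Qed.

(** More than [#|C|] focused lines would need too many colors. Focusing requires a letter below [l],
    so alphabets with at most one letter are treated apart. *)
Lemma HalesJewett l : HJ l.
Proof.
elim: l => [|l hl] C; first by exists 1 => c; exists [:: 0].
have [->|l0] := posnP l.
  by exists 1 => c; exists [:: 1]; split => // -[|x] [|y].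
have [n hn] := focusing C #|C|.+1 l0 hl; exists n => c.
have [//|[vs [w [svs _ _ _ uvs]]]] := hn c.
by have := max_card (mem [seq c (line l.+1 v 0) | v <- vs]);
  rewrite (card_uniqP uvs) size_map svs ltnn.
Qed.

Lemma index_notin_cat (x : nat) s t : x \notin s -> index x (s ++ t) = size s + index x t.
Proof. by rewrite index_cat => /negbTE ->. Qed.

Lemma line_wsubst l v x t : rigid l 1 v -> wsubst (iota 0 l ++ x :: t) v = line l v x.
Proof.
move=> h; apply/eq_in_map => y /(allP (rigid_bound h)); rewrite addn1 ltnS => yl.
rewrite !nth_cat size_iota; case: ltnP => // ly.
by have -> : y - l = 0 by lia.
Qed.

(* Hales-Jewett for all prefixes of a multidimensional space simultaneously;
   the prefixes of full length give the usual multidimensional version. *)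
Lemma prefix_HJ l m (C : finType) : 0 < l -> exists n, forall chi : seq nat -> C,
  exists sig kap, [/\ size sig = n, rigid l m sig &
   forall u, size u <= m -> all (fun y => y < l) u ->
     chi (wsubst (iota 0 l ++ u) (take (index (l + size u) sig) sig))
       = kap (size u)].
Proof.
move=> l0; elim: m C => [|m IH] C.
  exists 0 => chi; exists [::], (fun=> chi [::]); split=> // -[].
have [z hz] := HalesJewett l ({ffun 'I_m.+1 -> C} : finType).
have [n hn] := IH ({ffun z.-tuple 'I_l -> C} : finType).
exists (z + n) => chi.
have [sig [kap [ssig rsig hsig]]] :=
  hn (veccol z l (fun u w => chi (u ++ w))).
pose tk p := take (index (l + p) sig) sig.
have all0 p : all (fun y => y < l) (nseq p 0) by rewrite all_nseq l0 orbT.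
have chiE u u' : size u = z -> all (fun y => y < l) u -> size u' <= m ->
    all (fun y => y < l) u' ->
    chi (u ++ wsubst (iota 0 l ++ u') (tk (size u'))) =
    chi (u ++ wsubst (iota 0 l ++ nseq (size u') 0) (tk (size u'))).
  move=> su hu su' hu'.
  have e := hsig (nseq (size u') 0); rewrite size_nseq in e.
  exact: (veccolP (etrans (hsig u' su' hu') (esym (e su' (all0 _)))) su hu).
(* By [chiE] the color of a continuation depends on its length only, so a word of zeros represents
   each length [p]; one line [v] serves all [p] up to [m] together. *)
have [v [sv rv mv]] := hz (fun u => [ffun p : 'I_m.+1 =>
  chi (u ++ wsubst (iota 0 l ++ nseq p 0) (tk p))]).
exists (v ++ wshift l sig), (fun p => if p is q.+1
  then chi (line l v 0 ++ wsubst (iota 0 l ++ nseq q 0) (tk q))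
  else chi (wsubst (iota 0 l) (take (index l v) v))).
split; first by rewrite size_cat size_map sv ssig.
  by rewrite -[m.+1]add1n; apply: rigid_cat => //; rewrite addn1; apply: rigid_wshift.
case=> [_ _|x u] /=.
  have lv : l \in v by have := rigid_mem rv (isT : 0 < 1); rewrite addn0.
  by rewrite cats0 addn0 index_cat lv takel_cat // index_size.
rewrite ltnS => su /andP[xl hu].
have nv : l + (size u).+1 \notin v.
  by apply/negP => /(allP (rigid_bound rv)); lia.
rewrite index_notin_cat // take_cat ltnNge leq_addr /= addKn wsubst_cat.
rewrite line_wsubst // -[take _ (wshift _ _)]map_take.
have -> : l + (size u).+1 = bump l (l + size u) by rewrite /bump leq_addr addnS.
rewrite (index_map (can_inj (bumpK l))) wsubst_wshift chiE ?size_line //; last first.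
  exact: line_bound.
have /ffunP/(_ (inord (size u))) := mv x 0 xl l0.
by rewrite !ffunE inordK.
Qed.

(** * From Hales-Jewett to Graham-Rothschild, by prefixes *)

Definition pfx l w := take (find (leq l) w) w.

Lemma pfx_bound l w : all (fun y => y < l) (pfx l w).
Proof. by rewrite /pfx; elim: w => //= x w IH; case: leqP => //= ->. Qed.

Lemma size_pfx l w : size (pfx l w) = find (leq l) w.
Proof. by rewrite size_takel // find_size. Qed.

(** As [sig] introduces its parameters in order, the first letter [>= l] of the composition stands
    where [sig] first uses the parameter that receives the first such letter of [tau]. *)
Lemma find_wsubst pre l tau sig : all (fun y => y < l) pre ->
  rigid (size pre) (size tau) sig ->
  find (leq l) (wsubst (pre ++ tau) sig) = index (size pre + find (leq l) tau) sig.
Proof.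
elim: sig pre tau => [//|x sig IH] pre tau hp /=.
move=> /orP[/andP[xp h]|].
  rewrite nth_cat xp leqNgt (all_nthP 0 hp) //= IH //.
  by rewrite (ltn_eqF (ltn_addr _ xp)).
case: tau => [|y tau]; rewrite ?andbF // => /and3P[/eqP -> _ /= h].
rewrite nth_cat ltnn subnn /=; case: (leqP l y) => yl /=.
  by rewrite addn0 eqxx.
rewrite -cat_rcons IH ?size_rcons ?all_rcons ?yl //.
by rewrite addSnnS; case: eqP => //; lia.
Qed.

Lemma rigid_take_index l k w p : rigid l k w ->
  all (fun y => y < l + p) (take (index (l + p) w) w).
Proof.
elim: w l k p => //= x w IH l k p /orP[/andP[xl h]|/and3P[/eqP -> _ h]].
  by rewrite (ltn_eqF (ltn_addr p xl)) /= ltn_addr //=; apply: IH h.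
case: p => [|p]; first by rewrite addn0 eqxx.
rewrite addnS -addSn; case: eqP => [|_ /=]; first lia.
by rewrite addSn ltnS leq_addr /= -addSn (IH _ _ _ h).
Qed.

Lemma pfx_wsubst l k sig tau : rigid l (size tau) sig -> rigid l k tau ->
  pfx l (wsubst (iota 0 l ++ tau) sig) =
  wsubst (iota 0 l ++ pfx l tau) (take (index (l + find (leq l) tau) sig) sig).
Proof.
move=> hs ht; rewrite {1}/pfx find_wsubst ?iota_bound ?size_iota //.
rewrite -map_take; apply/eq_in_map => y /(allP (rigid_take_index _ hs)) yl.
rewrite !nth_cat size_iota; case: ltnP => // ly.
by rewrite nth_take //; lia.
Qed.

Definition GR l k := forall m (C : finType), exists n, forall c : seq nat -> C,
  exists sig i, [/\ size sig = n, rigid l m sig &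
    forall tau, size tau = m -> rigid l k tau -> c (wsubst (iota 0 l ++ tau) sig) = i].

(* The prefix before the first parameter determines the color. In the inductive
   step the first letter of the word is either the first parameter, handled by
   [GR l.+1 k] since that parameter is a constant from then on, or a constant. *)
Lemma GR_prefix l k m (C : finType) : GR l.+1 k ->
  exists n, forall c : seq nat -> C, exists sig (chi : seq nat -> C),
  [/\ size sig = n, rigid l m sig &
   forall tau, size tau = m -> rigid l k.+1 tau ->
     c (wsubst (iota 0 l ++ tau) sig) = chi (pfx l tau)].
Proof.
move=> gr; elim: m C => [|m IH] C.
  exists 0 => c; exists [::], (fun=> c [::]); split=> // -[].
have [M hM] := IH ({ffun 1.-tuple 'I_l -> C} : finType).
have [N hN] := gr M C.
exists N.+1 => c.
have [rho [i [srho rrho hrho]]] := hN (fun z => c (l :: z)).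
(* Words with a constant first letter, [u = [:: x]]; inside [rho] the letter [l] takes the same
   value [x]. The vector coloring treats all [x < l] at once. *)
pose c2 u t := c (u ++ wsubst (iota 0 l ++ u ++ t) rho).
have [sig [chi [ssig rsig hsig]]] := hM (veccol 1 l c2).
exists (l :: wsubst (iota 0 l.+1 ++ wshift l sig) rho),
  (fun u => if u is x :: u' then
     if (insub x : option 'I_l) is Some x' then chi u' [tuple x'] else i
     else i).
have r1 : rigid l.+1 m (wsubst (iota 0 l.+1 ++ wshift l sig) rho).
  apply: rigid_wsubst; first exact: iota_bound.
    exact: rigid_wshift.
  by rewrite size_iota size_map ssig.
split=> [||[|x tau] // /succn_inj stau htau].
- by rewrite /= size_wsubst srho.
- by rewrite /= eqxx ltnn /=; exact: r1.
have {}stau : size tau = m by [].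
rewrite wsubst_cons.
have -> : nth 0 (iota 0 l ++ x :: tau) l = x by rewrite nth_cat size_iota ltnn subnn.
rewrite wsubst_wsubst; last first.
  by rewrite size_cat size_iota size_map ssig rigid_bound.
rewrite wsubst_cat wsubst_wshift.
have -> : wsubst (iota 0 l ++ x :: tau) (iota 0 l.+1) = rcons (iota 0 l) x.
  rewrite -addn1 iotaD add0n wsubst_cat wsubst_id ?iota_bound //= nth_cat size_iota.
  by rewrite ltnn subnn cats1.
rewrite cat_rcons.
have rig2 k' l' : l <= l' -> rigid l' k' tau -> rigid l' k' (wsubst (iota 0 l ++ tau) sig).
  move=> ll' h; apply: rigid_wsubst => //; last by rewrite size_iota stau.
  by apply: sub_all (iota_bound l) => y /leq_trans; apply.
move: htau => /= /orP[/andP[xl htau]|/andP[/eqP -> htau]]; last first.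
  rewrite /pfx /= leqnn /= -cat_rcons.
  have -> : rcons (iota 0 l) l = iota 0 l.+1 by rewrite -[in RHS]addn1 iotaD cats1.
  by rewrite hrho ?size_wsubst //; apply: rig2.
rewrite /pfx /= leqNgt xl /= insubT /= -/(pfx l tau) -hsig // ffunE /=.
by rewrite /c2 /=.
Qed.

Fixpoint maskw l cur (b : seq bool) : seq nat :=
  match b with
  | [::] => [::]
  | true :: b' => l :: maskw l.+1 l b'
  | false :: b' => cur :: maskw l cur b'
  end.

Lemma size_maskw l cur b : size (maskw l cur b) = size b.
Proof. by elim: b l cur => //= -[] b IH l cur /=; rewrite IH. Qed.

Lemma rigid_maskw l cur b : cur < l -> rigid l (count id b) (maskw l cur b).
Proof.
elim: b l cur => //= -[] b IH l cur cl /=; last by rewrite cl IH.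
by rewrite eqxx ltnn /= IH.
Qed.

Lemma find_maskw pre l cur b tau : all (fun y => y < l) pre -> cur < size pre ->
  size tau = count id b -> has (leq l) tau ->
  nth false b (find (leq l) (wsubst (pre ++ tau) (maskw (size pre) cur b))).
Proof.
elim: b pre cur tau => [|[] b IH] pre cur tau hp hc /=.
- by move=> /size0nil ->.
- case: tau => // y tau [st] /=; rewrite nth_cat ltnn subnn /=.
  case: leqP => //= yl ht; rewrite -cat_rcons -(size_rcons pre y).
  by apply: IH; rewrite ?size_rcons ?all_rcons ?yl.
- move=> st ht; rewrite nth_cat hc leqNgt (all_nthP 0 hp) //=.
  exact: IH.
Qed.

Lemma submask b m : m <= count id b -> exists b', [/\ size b' = size b,
  count id b' = m & forall i, nth false b' i -> nth false b i].
Proof.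
elim: b m => [|x b IH] m /=; first by rewrite leqn0 => /eqP ->; exists [::].
case: m => [_|m].
  exists (nseq (size b).+1 false); split; first by rewrite size_nseq.
    by rewrite count_nseq.
  by move=> i; rewrite nth_nseq; case: ifP.
case: x => /=.
  rewrite ltnS => /IH[b' [sb cb hb]]; exists (true :: b'); split => //=.
  - by rewrite sb.
  - by rewrite cb.
  - by case.
move=> /IH[b' [sb cb hb]]; exists (false :: b'); split => //=; first by rewrite sb.
by case.
Qed.

Lemma pigeonhole (C : finType) (kap : nat -> C) m : 0 < #|C| ->
  exists i b, [/\ size b = #|C| * m, count id b = m &
    forall p, nth false b p -> kap p = i].
Proof.
move=> C0; have [i hi] : exists i, m <= count (fun p => kap p == i) (iota 0 (#|C| * m)).
  apply/existsP; apply: contraT; rewrite negb_exists => /forallP h.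
  have : \sum_(i : C) count (fun p => kap p == i) (iota 0 (#|C| * m)) = #|C| * m.
    rewrite -[RHS](size_iota 0) -sum1_size.
    under eq_bigr => i _ do rewrite -sum1_count big_mkcond.
    rewrite exchange_big /=; apply: eq_bigr => p _.
    by rewrite -big_mkcond /= (big_pred1 (kap p)) // => i; rewrite eq_sym.
  move=> e; have : \sum_(i : C) (count (fun p => kap p == i) (iota 0 (#|C| * m))).+1
     <= #|C| * m.
    by rewrite -[leqRHS]sum_nat_const; apply: leq_sum => i _; rewrite ltnNge h.
  under eq_bigr => i _ do rewrite -addn1.
  by rewrite big_split /= e sum1_card -[leqRHS]addn0 leq_add2l leqNgt C0.
pose b := [seq kap p == i | p <- iota 0 (#|C| * m)].
have [|b' [sb cb hb]] := @submask b m.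
  by rewrite /b count_map; apply: leq_trans hi _; rewrite leq_eqVlt eqxx.
exists i, b'; split=> //; first by rewrite sb size_map size_iota.
move=> p /hb; case: (ltnP p (#|C| * m)) => pm; last first.
  by rewrite nth_default // size_map size_iota.
by rewrite (nth_map 0) ?size_iota // nth_iota // => /eqP.
Qed.

Lemma rigid_has l k w : rigid l k.+1 w -> has (leq l) w.
Proof.
by move=> /rigid_mem/(_ (ltn0Sn k)) h; apply/hasP; exists (l + 0); rewrite // leq_addr.
Qed.

(* The color depends on the prefix only by [GR_prefix], on its length only by
   [prefix_HJ], and not at all after a pigeonhole argument on the lengths. *)
Theorem GrahamRothschild l k : 0 < l -> GR l k.
Proof.
elim: k l => [|k IH] l l0 m C.
  have [n hn] := prefix_HJ m C l0; exists n => c.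
  have [sig [kap [ssig rsig hsig]]] := hn c; exists sig, (kap m); split=> // tau st.
  rewrite rigid0 => /(hsig tau); rewrite st leqnn => <- //.
  by rewrite memNindex ?take_size //; apply/negP => /(allP (rigid_bound rsig)); rewrite ltnn.
pose m' := #|C| * m.
have [M hM] := prefix_HJ m' C l0.
have [n hn] := @GR_prefix l k M C (IH l.+1 isT).
exists n => c; have C0 : 0 < #|C| by apply/card_gt0P; exists (c [::]).
have [sA [chi [ssA rsA hA]]] := hn c.
have [sT [kap [ssT rsT hT]]] := hM chi.
have [i [b [sb cb hb]]] := pigeonhole kap m C0.
(* Composition with [rho] makes every prefix length a marked position of [b], where [kap] takes the
   single value [i]. *)
pose rho := maskw l 0 b.
have rrho : rigid l m rho by rewrite -cb; apply: rigid_maskw.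
have srho : size rho = m' by rewrite size_maskw.
have rigc k' t s : rigid l k' t -> rigid l (size t) s -> rigid l k' (wsubst (iota 0 l ++ t) s).
  by move=> ht hs; apply: rigid_wsubst; rewrite ?iota_bound ?size_iota.
pose sig1 := wsubst (iota 0 l ++ rho) sT.
have rsig1 : rigid l m sig1 by apply: rigc; rewrite ?srho.
exists (wsubst (iota 0 l ++ sig1) sA), i; split.
- by rewrite size_wsubst.
- by apply: rigc; rewrite ?size_wsubst ?ssT.
move=> tau stau rtau.
pose t1 := wsubst (iota 0 l ++ tau) rho.
have rt1 : rigid l k.+1 t1 by apply: rigc; rewrite ?stau.
pose t2 := wsubst (iota 0 l ++ t1) sT.
have rt2 : rigid l k.+1 t2 by apply: rigc; rewrite ?size_wsubst ?srho.
have comp t w s : rigid l (size w) s ->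
    wsubst (iota 0 l ++ t) (wsubst (iota 0 l ++ w) s) =
    wsubst (iota 0 l ++ wsubst (iota 0 l ++ t) w) s.
  move=> h; rewrite wsubst_wsubst; last by rewrite size_cat size_iota rigid_bound.
  by rewrite wsubst_cat wsubst_id ?iota_bound.
rewrite comp ?size_wsubst ?ssT // comp ?srho // hA ?size_wsubst //.
rewrite (@pfx_wsubst l k.+1) ?size_wsubst ?srho // -size_pfx hT ?pfx_bound //; last first.
  by rewrite size_pfx; apply: leq_trans (find_size _ _) _; rewrite size_wsubst srho.
apply: hb; rewrite size_pfx /t1 /rho.
have := find_maskw (cur := 0) (b := b) (tau := tau) (iota_bound l).
by rewrite size_iota stau cb => /(_ l0 (erefl _) (rigid_has rtau)).
Qed.

Local Open Scope classical_set_scope.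
Local Open Scope ring_scope.

(** * Norms on finite-dimensional spaces *)

Section Norms.
Variable R : realType.
Implicit Types (k l n : nat).

Section OneNorm.
Variables (k : nat) (N : 'rV[R]_k -> R).
Hypothesis hN : is_norm N.

Lemma is_normZ a x : N (a *: x) = `|a| * N x. Proof. by case: hN. Qed.
Lemma is_normD x y : N (x + y) <= N x + N y. Proof. by case: hN. Qed.
Lemma is_norm_eq0 x : N x = 0 -> x = 0. Proof. by case: hN => h _ _ /h. Qed.

Lemma is_norm0 : N 0 = 0.
Proof. by rewrite -(scale0r 0) is_normZ normr0 mul0r. Qed.

Lemma is_normN x : N (- x) = N x.
Proof. by rewrite -scaleN1r is_normZ normrN1 mul1r. Qed.

Lemma is_norm_ge0 x : 0 <= N x.
Proof.
have := is_normD x (- x); rewrite subrr is_norm0 is_normN => h.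
by rewrite -(pmulrn_lge0 _ (n := 2)) // mulr2n.
Qed.

Lemma is_normBC x y : N (x - y) = N (y - x).
Proof. by rewrite -is_normN opprB. Qed.

Lemma is_normB x y : N (x - y) <= N x + N y.
Proof. by rewrite -(is_normN y); exact: is_normD. Qed.

Lemma is_norm_sum (I : Type) (r : seq I) (P : pred I) (F : I -> 'rV[R]_k) :
  N (\sum_(i <- r | P i) F i) <= \sum_(i <- r | P i) N (F i).
Proof.
elim/big_rec2: _ => [|i y x _ h]; first by rewrite is_norm0.
by apply: le_trans (is_normD _ _) _; rewrite lerD2l.
Qed.

Lemma is_norm_gt0 x : x != 0 -> 0 < N x.
Proof.
by move=> x0; rewrite lt_neqAle is_norm_ge0 andbT eq_sym; apply: contraNneq x0
  => /is_norm_eq0 ->.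
Qed.

End OneNorm.

Lemma ler_linf n (x : 'rV[R]_n) i : `|x 0 i| <= linf x.
Proof. exact: (le_bigmax_cond 0 (fun j => `|x 0 j|)). Qed.

Lemma linf_le n (x : 'rV[R]_n) c : 0 <= c -> (forall i, `|x 0 i| <= c) ->
  linf x <= c.
Proof. by move=> c0 h; apply: bigmax_le => // i _; exact: h. Qed.

Lemma linf_ge0 n (x : 'rV[R]_n) : 0 <= linf x.
Proof. by apply: bigmax_ge_id. Qed.

Lemma linf_norm n : is_norm (@linf R n).
Proof.
split=> [x x0|a x|x y].
- apply/rowP => i; rewrite mxE; apply/eqP; rewrite -normr_le0.
  by rewrite -x0 ler_linf.
- apply/eqP; rewrite eq_le; apply/andP; split.
    apply: linf_le => [|i]; first by rewrite mulr_ge0 // linf_ge0.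
    by rewrite mxE normrM ler_wpM2l // ler_linf.
  have [->|a0] := eqVneq a 0; first by rewrite normr0 mul0r linf_ge0.
  rewrite -ler_pdivlMl ?normr_gt0 //; apply: linf_le => [|i].
    by rewrite mulr_ge0 ?linf_ge0 // invr_ge0.
  rewrite ler_pdivlMl ?normr_gt0 // -normrM.
  by have := ler_linf (a *: x) i; rewrite mxE.
- apply: linf_le => [|i]; first by rewrite addr_ge0 ?linf_ge0.
  by rewrite mxE; apply: le_trans (ler_normD _ _) _; rewrite lerD ?ler_linf.
Qed.

Lemma norm_le_linf k (N : 'rV[R]_k -> R) : is_norm N ->
  exists2 C : R, 0 < C & forall x, N x <= C * linf x.
Proof.
move=> hN; exists (1 + \sum_i N (delta_mx 0 i)) => [|x].
  by rewrite ltr_pwDl ?ltr01 // sumr_ge0 // => i _; exact: is_norm_ge0.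
rewrite {1}[x]row_sum_delta; apply: le_trans (is_norm_sum hN _ _ _) _.
rewrite mulrDl mul1r mulr_suml; apply: le_trans (_ : \sum_i N (delta_mx 0 i) * linf x <= _).
  apply: ler_sum => i _; rewrite (is_normZ hN) mulrC ler_wpM2l ?ler_linf //.
  exact: is_norm_ge0.
by rewrite lerDr linf_ge0.
Qed.

Lemma linf_mx_norm n (x : 'rV[R]_n) : linf x = `|x|.
Proof.
apply/eqP; rewrite eq_le; apply/andP; split.
  apply: linf_le => // i.
  rewrite [leRHS]/Num.norm /= mx_normrE.
  have := le_bigmax_cond 0 (fun ij : 'I_1 * 'I_n => `|x ij.1 ij.2|) (erefl : xpredT (0, i)).
  by [].
rewrite [leLHS]/Num.norm /= mx_normrE; apply: bigmax_le => [|[i j] _ /=].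
  exact: linf_ge0.
by rewrite (ord1 i) ler_linf.
Qed.

Lemma norm_continuous k (N : 'rV[R]_k -> R) : is_norm N -> continuous N.
Proof.
move=> hN x; have [C C0 hC] := norm_le_linf hN.
apply/(@cvgrPdist_le R R^o 'rV[R]_k (nbhs (x : 'rV[R]_k))) => e e0.
rewrite -nbhs_nearE; apply/(@nbhs_ballP R 'rV[R]_k).
exists (e / C) => [|z]; first by rewrite /= divr_gt0.
rewrite mx_norm_ball /ball_ /= => dz.
have sub u v : N u - N v <= N (u - v).
  by rewrite lerBlDr; have := is_normD hN (u - v) v; rewrite subrK.
have b : N (x - z) <= e.
  apply: le_trans (hC _) _; rewrite linf_mx_norm mulrC -ler_pdivlMr //.
  exact: ltW.
rewrite ler_norml lerNl opprB (le_trans (sub z x)) ?(le_trans (sub x z)) //.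
by rewrite (is_normBC hN).
Qed.

Lemma linf_bounded_compact k (A : set 'rV[R]_k) (M : R) :
  closed A -> (forall x, A x -> linf x <= M) -> compact A.
Proof.
move=> cA hM; apply: bounded_closed_compact => //; exists M; split.
  exact: num_real.
by move=> y My x /hM; rewrite linf_mx_norm => /le_trans; apply; exact: ltW.
Qed.

Lemma linf_le_norm k (N : 'rV[R]_k -> R) : is_norm N ->
  exists2 c : R, 0 < c & forall x, c * linf x <= N x.
Proof.
move=> hN; pose S := [set x : 'rV[R]_k | linf x = 1].
have hl := @linf_norm k.
have scal (x : 'rV[R]_k) : x != 0 -> S ((linf x)^-1 *: x).
  move=> x0; have := is_norm_gt0 hl x0 => lx.
  by rewrite /S /= (is_normZ hl) gtr0_norm ?invr_gt0 // mulVf // gt_eqF.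
have [[x0 Sx0]|nS] := pselect (S !=set0); last first.
  exists 1 => // x; have [->|/scal xS] := eqVneq x 0; last by case: nS; eexists; exact: xS.
  by rewrite !is_norm0 ?mulr0.
have cS : compact S.
  apply: (@linf_bounded_compact _ _ 1) => [|x ->//].
  apply: (@preimage_closed 'rV[R]_k R (@linf R k) [set x | x = 1]).
    by move=> x _; exact: norm_continuous.
  exact: closed_eq.
have [||c] := @EVT_min_rV R k N S _ cS; first by exists x0.
  by apply: continuous_subspaceT; exact: norm_continuous.
rewrite inE => cS1 hc; have c0 : c != 0.
  by apply/eqP => c0; move: cS1; rewrite /S /= c0 (is_norm0 hl) => /esym/eqP;
    rewrite oner_eq0.
exists (N c); first exact: is_norm_gt0.
move=> x; have [->|x1] := eqVneq x 0; first by rewrite !is_norm0 ?mulr0.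
have lx := is_norm_gt0 hl x1.
have := hc _ (mem_set (scal x x1)); rewrite (is_normZ hN) gtr0_norm ?invr_gt0 //.
by rewrite ler_pdivlMl // mulrC.
Qed.

Definition opbnd k l (NX : 'rV[R]_k -> R) (NY : 'rV[R]_l -> R) (A : 'M[R]_(k, l))
  (c : R) := forall x, NY (x *m A) <= c * NX x.

Section OpNorm.
Variables (k l : nat) (NX : 'rV[R]_k -> R) (NY : 'rV[R]_l -> R).
Hypotheses (hX : is_norm NX) (hY : is_norm NY).
Implicit Types A B : 'M[R]_(k, l).

Lemma opbnd_ex A : exists2 C : R, 0 <= C & opbnd NX NY A C.
Proof.
have [C C0 hC] := norm_le_linf hY; have [c c0 hc] := linf_le_norm hX.
pose M := \sum_i \sum_j `|A i j|.
have M0 : 0 <= M by apply: sumr_ge0 => i _; apply: sumr_ge0.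
exists (C * M / c) => [|x]; first by rewrite !mulr_ge0 ?invr_ge0 // ltW.
apply: le_trans (hC _) _; rewrite -!mulrA ler_pM2l //.
have hl : linf x <= c^-1 * NX x by rewrite ler_pdivlMl.
apply: le_trans (ler_wpM2l M0 hl); apply: linf_le => [|j].
  by rewrite mulr_ge0 ?linf_ge0.
rewrite mxE mulr_suml; apply: le_trans (ler_norm_sum _ _ _) _.
apply: ler_sum => i _; rewrite normrM mulrC.
apply: ler_pM => //; last exact: ler_linf.
by rewrite (bigD1 j) //= lerDl sumr_ge0.
Qed.

Lemma opnorm_le A c : 0 <= c -> opbnd NX NY A c -> opnorm NX NY A <= c.
Proof.
move=> c0 h; apply: ge_sup; first by exists (NY (0 *m A)), 0 => //=; rewrite is_norm0.
move=> _ [x /= x1 <-]; apply: le_trans (h x) _.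
by rewrite -[leRHS]mulr1 ler_wpM2l.
Qed.

Lemma opnorm_bnd A : opbnd NX NY A (opnorm NX NY A).
Proof.
move=> x; have [C C0 hC] := opbnd_ex A.
have [->|x0] := eqVneq x 0; first by rewrite mul0mx !is_norm0 ?mulr0.
have x1 := is_norm_gt0 hX x0.
rewrite -ler_pdivrMr // mulrC -[(NX x)^-1]gtr0_norm ?invr_gt0 //.
rewrite -(is_normZ hY) scalemxAl; apply: ub_le_sup.
  exists C => _ [y /= y1 <-]; apply: le_trans (hC y) _.
  by rewrite -[leRHS]mulr1 ler_wpM2l.
exists ((NX x)^-1 *: x) => //=.
by rewrite (is_normZ hX) gtr0_norm ?invr_gt0 // mulVf // gt_eqF.
Qed.

Lemma opnorm_ge0 A : 0 <= opnorm NX NY A.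
Proof.
have [C C0 hC] := opbnd_ex A.
have -> : 0 = NY (0 *m A) by rewrite mul0mx is_norm0.
apply: ub_le_sup.
  exists C => _ [y /= y1 <-]; apply: le_trans (hC y) _.
  by rewrite -[leRHS]mulr1 ler_wpM2l.
by exists 0; rewrite /= ?is_norm0.
Qed.

Lemma opbnd_le A c c' : c <= c' -> opbnd NX NY A c -> opbnd NX NY A c'.
Proof.
by move=> cc h x; apply: le_trans (h x) _; rewrite ler_wpM2r // is_norm_ge0.
Qed.

Lemma opbndZ A a c : opbnd NX NY A c -> opbnd NX NY (a *: A) (`|a| * c).
Proof.
move=> h x; rewrite -scalemxAr (is_normZ hY) -mulrA; exact: ler_wpM2l.
Qed.

Lemma opbndD A B c c' : opbnd NX NY A c -> opbnd NX NY B c' ->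
  opbnd NX NY (A + B) (c + c').
Proof.
move=> h h' x; rewrite mulmxDr mulrDl; apply: le_trans (is_normD hY _ _) _.
exact: lerD.
Qed.

Lemma opbndBC A B c : opbnd NX NY (A - B) c -> opbnd NX NY (B - A) c.
Proof. by move=> h x; rewrite -opprB mulmxN (is_normN hY). Qed.

Lemma opbnd_tri B A C c c' : opbnd NX NY (A - B) c -> opbnd NX NY (B - C) c' ->
  opbnd NX NY (A - C) (c + c').
Proof. by move=> h h'; have := opbndD h h'; rewrite addrA subrK. Qed.

(** Matrices are flattened so that nets of row vectors give nets of operators, with exponent
    [k * l]. *)
Lemma opnorm_is_norm :
  is_norm (fun v : 'rV[R]_(k * l) => opnorm NX NY (vec_mx v)).
Proof.
split=> [v v0|a v|v w].
- apply: (can_inj vec_mxK); rewrite linear0; apply/row_matrixP => i.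
  rewrite rowE row0; apply: (is_norm_eq0 hY); apply/eqP.
  by rewrite eq_le is_norm_ge0 // andbT; have := opnorm_bnd (vec_mx v) (delta_mx 0 i);
    rewrite v0 mul0r.
- rewrite linearZ /=; apply/eqP; rewrite eq_le; apply/andP; split.
    apply: opnorm_le; first by rewrite mulr_ge0 // opnorm_ge0.
    exact/opbndZ/opnorm_bnd.
  have [->|a0] := eqVneq a 0; first by rewrite normr0 mul0r opnorm_ge0.
  rewrite -ler_pdivlMl ?normr_gt0 //; apply: opnorm_le.
    by rewrite mulr_ge0 ?invr_ge0 ?opnorm_ge0.
  have := @opbndZ _ a^-1 _ (@opnorm_bnd (a *: vec_mx v)).
  by rewrite scalerA mulVf // scale1r normfV.
- rewrite linearD /=; apply: opnorm_le; first by rewrite addr_ge0 // opnorm_ge0.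
  by apply: opbndD; exact: opnorm_bnd.
Qed.

End OpNorm.

(** * The Hahn-Banach theorem for sublinear functionals *)

Section HahnBanach.
Variables (l : nat) (p : 'rV[R]_l -> R).
Hypotheses (pD : forall x y, p (x + y) <= p x + p y)
  (pZ : forall a x, 0 <= a -> p (a *: x) = a * p x).

(** The subspace is the row space of [A], and [f] is given on coefficient vectors; domination makes
    it well defined even if the rows are dependent. The value at [v] is the supremum of the lower
    constraints on it. *)
Lemma hahn_banach_step k (A : 'M[R]_(k, l)) (f : 'cV[R]_k) (v : 'rV[R]_l) :
  (forall x : 'rV_k, (x *m f) 0 0 <= p (x *m A)) ->
  exists c, forall (x : 'rV_k) (t : R), (x *m f) 0 0 + t * c <= p (x *m A + t *: v).
Proof.
move=> h; pose E := [set (x *m f) 0 0 - p (x *m A - v) | x in [set: 'rV[R]_k]].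
have ubE (y : 'rV_k) : ubound E (p (y *m A + v) - (y *m f) 0 0).
  move=> _ [x _ <-]; rewrite lerBrDr addrAC lerBlDr.
  have := h (x + y); rewrite mulmxDl [X in X <= _]mxE => /le_trans; apply.
  rewrite mulmxDl; apply: le_trans (pD _ _); rewrite le_eqVlt; apply/orP; left.
  by apply/eqP; congr p; rewrite addrACA subrr addr0 // addrC.
have E0 : E !=set0 by eexists; exists (0 : 'rV_k).
exists (sup E) => x t.
have hs : has_sup E by split=> //; eexists; exact: (ubE 0).
have up (y : 'rV_k) : (y *m f) 0 0 + sup E <= p (y *m A + v).
  by rewrite addrC -lerBrDr; apply: ge_sup (ubE y).
have lo (y : 'rV_k) : (y *m f) 0 0 - sup E <= p (y *m A - v).
  rewrite lerBlDr addrC -lerBlDr; apply: ub_le_sup; first by case: hs.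
  by exists y.
have sA (u : R) m (B : 'M[R]_(k, m)) : (u *: x) *m B = u *: (x *m B).
  by rewrite scalemxAl.
have [t0|t0|->] := ltgtP t 0; last first.
- by rewrite mul0r scale0r !addr0; exact: h.
- have H := up (t^-1 *: x); rewrite -(ler_pM2l t0) -(pZ _ (ltW t0)) !sA mxE in H; move: H.
  by rewrite mulrDr mulrA divff ?gt_eqF // mul1r scalerDr scalerA divff ?gt_eqF
    // scale1r.
- have t0' : 0 < - t by rewrite oppr_gt0.
  have H := lo ((- t)^-1 *: x); rewrite -(ler_pM2l t0') -(pZ _ (ltW t0')) !sA mxE in H; move: H.
  rewrite mulrBr mulrA divff ?gt_eqF // mul1r scalerBr scalerA.
  by rewrite divff ?gt_eqF // scale1r mulNr scaleNr !opprK.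
Qed.

Lemma hahn_banach_add k j (A : 'M[R]_(k, l)) (f : 'cV[R]_k) (B : 'M[R]_(j, l)) :
  (forall x : 'rV_k, (x *m f) 0 0 <= p (x *m A)) ->
  exists g : 'cV[R]_j, forall (x : 'rV_k) (y : 'rV_j),
    (x *m f) 0 0 + (y *m g) 0 0 <= p (x *m A + y *m B).
Proof.
move=> h; elim: j B => [|j IH] B.
  exists 0 => x y; rewrite [y]thinmx0 !mul0mx [X in _ + X]mxE !addr0.
  exact: h.
move: B; rewrite -[j.+1]/(1 + j)%N => B.
have [g hg] := IH (dsubmx B).
have [|c hc] := @hahn_banach_step (k + j) (col_mx A (dsubmx B)) (col_mx f g)
    (usubmx B).
  by move=> x; rewrite -[x]hsubmxK !mul_row_col mxE.
exists (col_mx c%:M g) => x y.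
have := hc (row_mx x (rsubmx y)) (lsubmx y 0 0).
rewrite !mul_row_col mxE.
have -> : (y *m col_mx c%:M g) 0 0 = lsubmx y 0 0 * c + (rsubmx y *m g) 0 0.
  rewrite -[y in LHS]hsubmxK mul_row_col mxE; congr (_ + _).
  by rewrite mul_mx_scalar mxE mulrC.
have -> : y *m B = lsubmx y 0 0 *: usubmx B + rsubmx y *m dsubmx B.
  rewrite -[y in LHS]hsubmxK -[B in LHS]vsubmxK mul_row_col; congr (_ + _).
  by rewrite -mul_scalar_mx; congr (_ *m _); exact: mx11_scalar.
by rewrite -!addrA [X in _ + X <= _]addrC [X in p (_ + X)]addrC.
Qed.

(** Adjoining the whole standard basis gives [g] with [x f + y g <= p (x A + y)]. For [y = - x A]
    the right side is [p 0 = 0], so [f - A g] is nonpositive on a linear space, hence zero. *)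
Lemma hahn_banach k (A : 'M[R]_(k, l)) (f : 'cV[R]_k) :
  (forall x : 'rV_k, (x *m f) 0 0 <= p (x *m A)) ->
  exists g : 'cV[R]_l, A *m g = f /\ forall y : 'rV_l, (y *m g) 0 0 <= p y.
Proof.
move=> /(hahn_banach_add 1%:M)[g hg].
exists g; split=> [|y]; last first.
  by have := hg 0 y; rewrite !mul0mx mxE !add0r mulmx1.
have p0 : p 0 = 0 by have := pZ 0 (lexx 0); rewrite scale0r mul0r.
have le0 (x : 'rV_k) : (x *m (f - A *m g)) 0 0 <= 0.
  have := hg x (- (x *m A)); rewrite mulmx1 subrr p0 mulNmx -mulmxA => h1.
  by rewrite mulmxBr mxE; move: h1; rewrite !mxE.
apply/esym/eqP; rewrite -subr_eq0; apply/eqP/matrixP => i j; rewrite ord1 [RHS]mxE.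
have e (u : 'cV[R]_k) : u i 0 = ((delta_mx 0 i : 'rV_k) *m u) 0 0.
  rewrite [RHS]mxE (bigD1 i) //= mxE !eqxx mul1r big1 ?addr0 // => m /negbTE mi.
  by rewrite mxE mi andbF mul0r.
apply/eqP; rewrite eq_le e le0 /= -oppr_le0.
by have := le0 (- delta_mx 0 i); rewrite mulNmx mxE.
Qed.

End HahnBanach.

End Norms.

(** * Packings and nets *)

Section Packing.
Variable R : realType.

Lemma bernoulli (e : R) n : 0 <= e -> 1 + n%:R * e <= (1 + e) ^+ n.
Proof.
move=> e0; elim: n => [|n IH]; first by rewrite mul0r addr0 expr0.
rewrite exprS; apply: le_trans (ler_wpM2l _ IH); last by rewrite addr_ge0.
have : 0 <= n%:R * e * e :> R by rewrite !mulr_ge0.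
rewrite -natr1; lra.
Qed.

Lemma bounded_powers (q D : R) : (forall n, q ^+ n <= D) -> q <= 1.
Proof.
move=> h; rewrite leNgt; apply/negP => q1.
have e0 : 0 < q - 1 by rewrite subr_gt0.
pose n := (Num.truncn (D / (q - 1))).+1.
have : D < n%:R * (q - 1) by rewrite -ltr_pdivrMr //; exact: truncnS_gt.
have b := bernoulli n (ltW e0); rewrite [1 + (q - 1)]addrC subrK in b.
have := le_trans b (h n); lra.
Qed.

Section OneNorm.
Variables (k : nat) (N : 'rV[R]_k -> R).
Hypothesis hN : is_norm N.

Definition separated (d : R) (s : seq 'rV[R]_k) := uniq s /\
  forall x y, x \in s -> y \in s -> x != y -> d <= N (x - y).

(** Points in one cell of a cubic grid of mesh [h] are within [d / 2] of each other, so it suffices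
    to count cells. The bound is crude, but its constant does not depend on [d]. *)
Lemma separated_count (rho : R) : 0 <= rho -> exists2 C : R, 0 < C &
  forall d s, 0 < d -> separated d s -> (forall x, x \in s -> N x <= rho) ->
    (size s)%:R <= (C / d + 1) ^+ k.
Proof.
move=> rho0; have [C C0 hC] := norm_le_linf hN; have [c c0 hc] := linf_le_norm hN.
exists (4 * rho * C / c + 1) => [|d s d0 [us ss] hs].
  by rewrite ltr_wpDl // !mulr_ge0 ?invr_ge0 // ltW.
pose h := d / (2 * C); have h0 : 0 < h by rewrite divr_gt0 // mulr_gt0.
pose r := rho / c; have r0 : 0 <= r by rewrite divr_ge0 // ltW.
pose B := Num.truncn (2 * r / h).
pose g (x : 'rV[R]_k) i := Num.truncn ((x 0 i + r) / h).
have bx x i : x \in s -> `|x 0 i| <= r.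
  move=> /hs xr; apply: le_trans (ler_linf x i) _.
  by rewrite /r ler_pdivlMr // mulrC (le_trans (hc x)).
have pos x i : x \in s -> 0 <= (x 0 i + r) / h.
  move=> xs; have := bx x i xs; rewrite ler_norml => /andP[h1 _].
  by rewrite divr_ge0 ?(ltW h0) //; lra.
have gB x i : x \in s -> (g x i < B.+1)%N.
  move=> xs; rewrite ltnS; apply: le_truncn; rewrite ler_pM2r ?invr_gt0 //.
  by have := bx _ i xs; rewrite ler_norml => /andP[_]; lra.
pose f x : {ffun 'I_k -> 'I_B.+1} := [ffun i => inord (g x i)].
have finj : {in s &, injective f}.
  move=> x y xs ys fxy; apply/eqP; apply: contraT => nxy.
  have gxy i : g x i = g y i.
    by move/ffunP: fxy => /(_ i); rewrite !ffunE => /(congr1 val); rewrite /= !inordK ?gB.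
  have : N (x - y) <= C * h.
    apply: le_trans (hC _) _; rewrite ler_pM2l //; apply: linf_le => [|i]; first exact: ltW.
    have := truncn_itv (pos x i xs); have := truncn_itv (pos y i ys).
    have -> : Num.truncn ((x 0 i + r) / h) = Num.truncn ((y 0 i + r) / h) by exact: gxy.
    rewrite -natr1 => /andP[h1 h2] /andP[h3 h4].
    have -> : (x - y) 0 i = ((x 0 i + r) / h - (y 0 i + r) / h) * h.
      by rewrite !mxE; field; rewrite gt_eqF.
    rewrite normrM (gtr0_norm h0) -[leRHS]mul1r ler_pM2r // ler_norml; lra.
  have -> : C * h = d / 2 by rewrite /h; field; lra.
  by have := ss x y xs ys nxy; lra.
have : (size s <= B.+1 ^ k)%N.
  rewrite -(size_map f) -[X in (_ <= X ^ k)%N]card_ord -[k in (_ ^ k)%N]card_ord -card_ffun.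
  by rewrite cardE uniq_leq_size ?map_inj_in_uniq // => z _; rewrite mem_enum.
rewrite -(ler_nat R) natrX => /le_trans; apply; apply: lerXn2r.
- by rewrite nnegrE.
- by rewrite nnegrE addr_ge0 // divr_ge0 ?ltW // ltr_wpDl // !mulr_ge0 ?invr_ge0 // ltW.
have /truncn_itv/andP[hB _] : 0 <= 2 * r / h.
  by apply: divr_ge0; [exact: mulr_ge0 | exact: ltW].
rewrite -natr1 lerD2r; apply: le_trans hB _.
have -> : 2 * r / h = (4 * rho * C / c) / d by rewrite /r /h; field; lra.
by rewrite ler_pM2r ?invr_gt0 // lerDl.
Qed.

(* The points [x_0 + t x_1 + ... + t^(J-1) x_(J-1)] with digits in [s]; for
   [t = d / (2 + d)] they are separated, which makes the crude bound
   [separated_count] sharp in the limit. *)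
Lemma separated_digits d s J : 0 < d -> separated d s ->
  (forall x, x \in s -> N x <= 1) -> let t := d / (2 + d) in
  exists sJ, [/\ size sJ = (size s ^ J)%N, separated (2 * t ^+ J / (1 - t)) sJ &
    forall x, x \in sJ -> N x <= (1 - t ^+ J) / (1 - t)].
Proof.
move=> d0 [us ss] hs t.
have t0 : 0 < t by rewrite divr_gt0 // addr_gt0.
have t1 : 0 < 1 - t by rewrite subr_gt0 ltr_pdivrMr ?addr_gt0 // mul1r ltrDr.
(* The choice of [t] makes [d] equal to 2 (t + t^2 + ...), which bounds the diameter of the set of
   infinite tails; cutting the tails after [J] digits leaves the separation 2 t^(J+1) / (1 - t). *)
have dE : d = 2 * t / (1 - t) by rewrite /t; field; lra.
elim: J => [|J [sJ [sz [usJ ssJ] hsJ]]].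
  exists [:: 0]; split=> [//||x]; last first.
    by rewrite inE => /eqP ->; rewrite is_norm0 // expr0 subrr mul0r.
  by split=> // x y; rewrite !inE => /eqP -> /eqP ->; rewrite eqxx.
have far x x' y y' : x \in s -> x' \in s -> y \in sJ -> y' \in sJ -> x != x' ->
    2 * t ^+ J.+1 / (1 - t) <= N (x + t *: y - (x' + t *: y')).
  move=> xs xs' ys ys' nx.
  have -> : x + t *: y - (x' + t *: y') = (x - x') - (t *: (y' - y)).
    by rewrite scalerBr opprB opprD addrACA.
  have h1 := ss x x' xs xs' nx.
  have h2 : N (t *: (y' - y)) <= t * (2 * ((1 - t ^+ J) / (1 - t))).
    rewrite is_normZ // gtr0_norm // ler_pM2l //.
    apply: le_trans (is_normB hN _ _) _; have := hsJ _ ys; have := hsJ _ ys'; lra.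
  have h3 : N (x - x') <= N (x - x' - t *: (y' - y)) + N (t *: (y' - y)).
    by have := is_normD hN (x - x' - t *: (y' - y)) (t *: (y' - y)); rewrite subrK.
  have : 2 * t ^+ J.+1 / (1 - t) = d - t * (2 * ((1 - t ^+ J) / (1 - t))).
    by rewrite dE exprS; field; lra.
  lra.
have tJ0 : 0 < 2 * t ^+ J.+1 / (1 - t) by rewrite divr_gt0 // mulr_gt0 // exprn_gt0.
exists [seq x + t *: y | x <- s, y <- sJ]; split.
- by rewrite size_allpairs sz expnS.
- split.
    apply: allpairs_uniq => // -[x y] [x' y'] /allpairsP[[x1 y1] /= [x1s y1s [-> ->]]].
    move=> /allpairsP[[x2 y2] /= [x2s y2s [-> ->]]] e.
    have [xe|nx] := eqVneq x1 x2; last first.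
      by have := far _ _ _ _ x1s x2s y1s y2s nx; rewrite e subrr is_norm0 // leNgt tJ0.
    by move: e; rewrite xe => /addrI/(scalerI (lt0r_neq0 t0)) ->.
  move=> _ _ /allpairsP[[x y] /= [xs ys ->]] /allpairsP[[x' y'] /= [xs' ys' ->]] nz.
  have [xe|nx] := eqVneq x x'; last exact: far.
  have ny : y != y' by apply: contraNneq nz => ->; rewrite xe.
  have -> : x + t *: y - (x' + t *: y') = t *: (y - y').
    by rewrite xe opprD addrACA subrr add0r scalerBr.
  rewrite is_normZ // gtr0_norm //.
  have -> : 2 * t ^+ J.+1 / (1 - t) = t * (2 * t ^+ J / (1 - t)).
    by rewrite exprS; field; lra.
  by rewrite ler_pM2l // ssJ.
- move=> _ /allpairsP[[x y] /= [xs ys ->]].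
  apply: le_trans (is_normD hN _ _) _; rewrite is_normZ // gtr0_norm //.
  have -> : (1 - t ^+ J.+1) / (1 - t) = 1 + t * ((1 - t ^+ J) / (1 - t)).
    by rewrite exprS; field; lra.
  by rewrite lerD ?hs // ler_pM2l // hsJ.
Qed.

(** The [J]-digit expansions are [size s ^ J] points with separation of order [t ^ J] in a fixed
    ball, so by the crude bound the powers of [size s * t ^ k] stay bounded, and this number is at
    most one; here [t^-1 = 1 + 2 / d]. *)
Lemma separated_size d s : 0 < d -> separated d s ->
  (forall x, x \in s -> N x <= 1) -> (size s)%:R <= (1 + 2 / d) ^+ k.
Proof.
move=> d0 ss hs; pose t := d / (2 + d).
have t0 : 0 < t by rewrite divr_gt0 // addr_gt0.
have t1 : 0 < 1 - t by rewrite subr_gt0 ltr_pdivrMr ?addr_gt0 // mul1r ltrDr.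
have -> : 1 + 2 / d = t^-1 by rewrite /t; field; lra.
have r0 : 0 <= (1 - t)^-1 by rewrite invr_ge0 ltW.
have [C C0 hC] := separated_count r0.
rewrite exprVn -[leRHS]mul1r ler_pdivlMr ?exprn_gt0 //.
apply: (@bounded_powers _ ((C / (2 / (1 - t)) + 1) ^+ k)) => J.
have [sJ [sz sepJ hsJ]] := separated_digits J d0 ss hs; rewrite -/t in sepJ hsJ.
have tJ : 0 < t ^+ J by rewrite exprn_gt0.
have tJ1 : t ^+ J <= 1 by rewrite exprn_ile1 ?ltW // -subr_gt0.
have sep0 : 0 < 2 * t ^+ J / (1 - t) by rewrite divr_gt0 // mulr_gt0.
have hsJ' x : x \in sJ -> N x <= (1 - t)^-1.
  move=> /hsJ/le_trans; apply; rewrite ler_pdivrMr // mulVf; last by rewrite gt_eqF.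
  by rewrite lerBlDr lerDl ltW.
have := hC _ _ sep0 sepJ hsJ'; rewrite sz natrX => h.
rewrite exprMn -exprM mulnC exprM.
rewrite -ler_pdivlMr ?exprn_gt0 // -exprVn -exprMn; apply: le_trans h _.
apply: lerXn2r; rewrite ?nnegrE.
- by rewrite addr_ge0 // ltW // divr_gt0.
- by rewrite mulr_ge0 ?invr_ge0 ?(ltW tJ) // addr_ge0 // ltW // !divr_gt0.
rewrite [leRHS]mulrDl mul1r; apply: lerD; last by rewrite invf_ge1.
by rewrite le_eqVlt; apply/orP; left; apply/eqP; field; lra.
Qed.

(** A separated subset of [S] of maximal size, which exists by [separated_size], is a net. Its
    points lie in [S], so a net of embeddings consists of embeddings. *)
Lemma net_ex (S : set 'rV[R]_k) d : 0 < d -> (forall x, S x -> N x <= 1) ->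
  exists s, [/\ forall x, x \in s -> S x, (size s)%:R <= (1 + 2 / d) ^+ k &
    forall x, S x -> exists2 y, y \in s & N (x - y) <= d].
Proof.
move=> d0 hS.
pose P n := `[< exists s, [/\ size s = n, separated d s & forall x, x \in s -> S x] >].
have Pb n : P n -> (n <= Num.truncn ((1 + 2 / d) ^+ k))%N.
  move=> /asboolP[s [<- ss hs]]; rewrite truncn_ge_nat; last first.
    by rewrite exprn_ge0 // addr_ge0 // divr_ge0 // ltW.
  by apply: separated_size => // x /hs/hS.
have P0 : exists n, P n by exists 0%N; apply/asboolP; exists [::]; split.
case: (ex_maxnP P0 Pb) => n /asboolP[s [sn ss hs]] nmax.
exists s; split=> //; first by apply: separated_size => // x /hs/hS.
move=> x Sx; have [//|hx] := pselect (exists2 y, y \in s & N (x - y) <= d).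
have far y : y \in s -> d < N (x - y).
  by move=> ys; rewrite ltNge; apply/negP => h; apply: hx; exists y.
have xs : x \notin s.
  by apply/negP => /far; rewrite subrr is_norm0 // ltNge ltW.
have : P n.+1.
  apply/asboolP; exists (x :: s); case: ss => us ss; split.
  - by rewrite /= sn.
  - split=> [|y z]; first by rewrite /= xs.
    rewrite !inE => /orP[/eqP ->|ys] /orP[/eqP ->|zs]; rewrite ?eqxx // => nyz.
    + exact/ltW/far.
    + by rewrite is_normBC //; exact/ltW/far.
    + exact: ss.
  - by move=> y; rewrite inE => /orP[/eqP ->//|/hs].
by move=> /nmax; rewrite ltnn.
Qed.

End OneNorm.

Lemma opnet_ex k l (NX : 'rV[R]_k -> R) (NY : 'rV[R]_l -> R) (S : set 'M[R]_(k, l)) d :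
  is_norm NX -> is_norm NY -> 0 < d -> (forall A, S A -> opbnd NX NY A 1) ->
  exists s, [/\ forall A, A \in s -> S A, (size s)%:R <= (1 + 2 / d) ^+ (k * l) &
    forall A, S A -> exists2 B, B \in s & opbnd NX NY (A - B) d].
Proof.
move=> hX hY d0 hS; have hN := opnorm_is_norm hX hY.
have [|s [hs sz net]] := net_ex hN (S := [set v | S (vec_mx v)]) d0.
  by move=> v /hS; exact: opnorm_le.
exists (map vec_mx s); split=> [A /mapP[v /hs + ->] //||A SA].
  by rewrite size_map.
have [|v vs hv] := net (mxvec A); first by rewrite /= mxvecK.
exists (vec_mx v); first exact: map_f.
apply: opbnd_le hv _ => //; rewrite linearB /= mxvecK.
exact: opnorm_bnd.
Qed.

End Packing.

(** * Embeddings between the spaces linf *)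

(** Pass [t] introduces the letter [l + t] and nothing larger, while smaller letters are free; this
    is the freedom that rounding to earlier labels exploits. *)
Lemma rigid_passes (X : eqType) l N (f : nat -> X -> nat) (L : seq X) :
  (forall t x, (t < N)%N -> x \in L -> (f t x <= l + t)%N) ->
  (forall t, (t < N)%N -> exists2 x, x \in L & f t x = (l + t)%N) ->
  rigid l N [seq f t x | t <- iota 0 N, x <- L].
Proof.
elim: N => [//|N IH] hle hex; rewrite -[N.+1]addn1 iotaD allpairs_cat.
apply: rigid_cat; first by apply: IH => [t x tN|t tN]; [apply: hle|apply: hex]; exact: ltnW.
rewrite /= cats0 add0n; apply: rigid1.
  by apply/allP => _ /mapP[x xL ->]; exact: hle.
by have [x xL <-] := hex N (ltnSn N); exact: map_f.
Qed.

Section Linf.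
Variable R : realType.

Definition l1 k (x : 'cV[R]_k) : R := \sum_i `|x i 0|.

Lemma l1_ge0 k (x : 'cV[R]_k) : 0 <= l1 x.
Proof. by apply: sumr_ge0. Qed.

Lemma l1_0 k : l1 (0 : 'cV[R]_k) = 0.
Proof. by rewrite /l1 big1 // => i _; rewrite mxE normr0. Qed.

Lemma l1Z k a (x : 'cV[R]_k) : l1 (a *: x) = `|a| * l1 x.
Proof. by rewrite /l1 mulr_sumr; apply: eq_bigr => i _; rewrite mxE normrM. Qed.

Lemma l1D k (x y : 'cV[R]_k) : l1 (x + y) <= l1 x + l1 y.
Proof. by rewrite -big_split /=; apply: ler_sum => i _; rewrite mxE ler_normD. Qed.

Lemma l1_sum k (I : Type) (r : seq I) (P : pred I) (F : I -> 'cV[R]_k) :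
  l1 (\sum_(i <- r | P i) F i) <= \sum_(i <- r | P i) l1 (F i).
Proof.
elim/big_rec2: _ => [|i y x _ h]; first by rewrite l1_0.
by apply: le_trans (l1D _ _) _; rewrite lerD2l.
Qed.

Lemma l1_delta k (i : 'I_k) : l1 (delta_mx i 0 : 'cV[R]_k) = 1.
Proof.
rewrite /l1 (bigD1 i) //= mxE !eqxx normr1 big1 ?addr0 // => j /negbTE ji.
by rewrite mxE ji normr0.
Qed.

Lemma colE_sum k n (A : 'M[R]_(k, n)) (q : 'cV[R]_n) :
  A *m q = \sum_j q j 0 *: col j A.
Proof.
apply/matrixP => i j; rewrite !mxE summxE; apply: eq_bigr => p _.
by rewrite !mxE (ord1 j) mulrC.
Qed.

Lemma l1_mulmx k n (A : 'M[R]_(k, n)) (q : 'cV[R]_n) :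
  (forall p, l1 (col p A) <= 1) -> l1 (A *m q) <= l1 q.
Proof.
move=> hA; rewrite colE_sum; apply: le_trans (l1_sum _ _ _) _.
by apply: ler_sum => p _; rewrite l1Z -[leRHS]mulr1 ler_wpM2l.
Qed.

Lemma opbnd_linf k n (A : 'M[R]_(k, n)) c : 0 <= c ->
  (forall p, l1 (col p A) <= c) -> opbnd (@linf R k) (@linf R n) A c.
Proof.
move=> c0 h x; apply: linf_le => [|p]; first by rewrite mulr_ge0 ?linf_ge0.
rewrite mxE; apply: le_trans (ler_norm_sum _ _ _) _.
apply: le_trans (ler_wpM2r (linf_ge0 x) (h p)); rewrite mulr_suml.
by apply: ler_sum => i _; rewrite normrM mulrC mxE ler_wpM2l // ler_linf.
Qed.

Lemma linf_opbnd_col k n (A : 'M[R]_(k, n)) c p : 0 <= c ->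
  opbnd (@linf R k) (@linf R n) A c -> l1 (col p A) <= c.
Proof.
move=> c0 h; pose x : 'rV[R]_k := \row_i Num.sg (A i p).
have x1 : linf x <= 1.
  by apply: linf_le => // i; rewrite mxE normr_sg; case: (_ != _).
have e : (x *m A) 0 p = l1 (col p A).
  by rewrite mxE; apply: eq_bigr => i _; rewrite !mxE normrEsg.
rewrite -e; apply: le_trans (ler_norm _) _; apply: le_trans (ler_linf _ _) _.
by apply: le_trans (h x) _; rewrite -[leRHS]mulr1 ler_wpM2l.
Qed.

Definition has_unit_col k n (A : 'M[R]_(k, n)) i :=
  exists p (b : bool), col p A = (-1) ^+ b *: delta_mx i 0.

Lemma linf_isEmb k n (A : 'M[R]_(k, n)) : (forall p, l1 (col p A) <= 1) ->
  (forall i, has_unit_col A i) -> isEmb (@linf R k) (@linf R n) A.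
Proof.
move=> h1 h2 x; apply/eqP; rewrite eq_le; apply/andP; split.
  by rewrite -[leRHS]mul1r; exact: opbnd_linf.
apply: linf_le => [|i]; first exact: linf_ge0.
have [p [b hp]] := h2 i; apply: le_trans (ler_linf _ p).
rewrite mxE (bigD1 i) //= big1 ?addr0.
  have /matrixP/(_ i 0) := hp; rewrite !mxE !eqxx mulr1 => ->.
  by rewrite normrM normrX normrN1 expr1n mulr1.
move=> j /negbTE ji; have /matrixP/(_ j 0) := hp; rewrite !mxE ji mulr0 => ->.
by rewrite mulr0.
Qed.

Lemma isEmb_opbnd k n (NX : 'rV[R]_k -> R) (NY : 'rV[R]_n -> R) A :
  isEmb NX NY A -> opbnd NX NY A 1.
Proof. by move=> h x; rewrite h mul1r. Qed.

(** The image of the [i]-th unit vector has sup norm one, attained in some column [p]; that column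
    lies in the unit ball of l1, so its other entries vanish. *)
Lemma linf_isEmb_unit_col k n (A : 'M[R]_(k, n)) i :
  isEmb (@linf R k) (@linf R n) A -> has_unit_col A i.
Proof.
move=> hA; have e1 : linf (delta_mx 0 i : 'rV[R]_k) = 1.
  apply/eqP; rewrite eq_le; apply/andP; split.
    by apply: linf_le => // j; rewrite mxE; case: (_ && _); rewrite ?normr1 ?normr0.
  by have := ler_linf (delta_mx 0 i : 'rV[R]_k) i; rewrite mxE !eqxx normr1.
have := hA (delta_mx 0 i); rewrite e1 -rowE => hl.
have [p hp] : exists p, 1 <= `|A i p|.
  apply/existsP; apply: contraT; rewrite negb_exists => /forallP h.
  suff : linf (row i A) < 1 by rewrite hl ltxx.
  by apply: bigmax_lt => // p _; rewrite mxE ltNge.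
have := linf_opbnd_col p ler01 (isEmb_opbnd hA); rewrite /l1 (bigD1 i) //= mxE => hc.
have z j : j != i -> A j p = 0.
  move=> ji; apply/eqP; rewrite -normr_le0.
  have : `|A j p| <= \sum_(i0 < k | i0 != i) `|col p A i0 0|.
    by rewrite (bigD1 j) //= mxE lerDl sumr_ge0.
  by move: hc hp; lra.
have e : `|A i p| = 1.
  apply/eqP; rewrite eq_le hp andbT; apply: le_trans hc.
  by rewrite lerDl sumr_ge0.
exists p, (A i p < 0); apply/matrixP => j q; rewrite !mxE (ord1 q) andbT.
have [->|/z ->] := eqVneq j i; last by rewrite mulr0.
by rewrite mulr1 -[LHS]mulr_sign_norm e mulr1.
Qed.

(* [label al y] is the vector with letter [y]: letter [0] is the zero vector and
   letter [t + 1] the [t]-th element of [al]. *)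
Definition label k (al : seq 'cV[R]_k) y : 'cV[R]_k := nth 0 (0 :: al) y.

Lemma label_cat k (al al' : seq 'cV[R]_k) y : (y <= size al)%N ->
  label (al ++ al') y = label al y.
Proof. by move=> h; rewrite /label -cat_cons nth_cat /= ltnS h. Qed.

(* Rounding can always be done with an earlier label. *)
Definition dense_labels k (al : seq 'cV[R]_k) e := forall t, (t < size al)%N ->
  forall x, l1 x <= l1 (nth 0 al t) ->
  exists2 y, (y <= t)%N & l1 (x - label al y) <= e.

Lemma l1_net k (e : R) : 0 < e -> exists D : seq 'cV[R]_k,
  [/\ forall i, delta_mx i 0 \in D, forall y, y \in D -> l1 y <= 1 &
   forall x, l1 x <= 1 -> exists2 y, y \in D & l1 (x - y) <= e].
Proof.
move=> e0.
have [|s [hs _ net]] := opnet_ex (S := [set A : 'M[R]_(k, 1) | l1 A <= 1])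
   (linf_norm R k) (linf_norm R 1) e0.
  by move=> A hA; apply: opbnd_linf => // p; rewrite (ord1 p) col_id.
exists ([seq delta_mx i 0 | i <- enum 'I_k] ++ s); split.
- move=> i; rewrite mem_cat; apply/orP; left; apply/mapP; exists i => //.
  by rewrite mem_enum.
- move=> y; rewrite mem_cat => /orP[/mapP[i _ ->]|/hs//].
  by rewrite l1_delta.
- move=> x /net[y ys hy]; exists y; first by rewrite mem_cat ys orbT.
  by have := linf_opbnd_col ord0 (ltW e0) hy; rewrite col_id.
Qed.

(** Scaled copies of a net of the l1 ball, at the levels [1 / K], [2 / K], ..., [1]. A vector of
    norm at most level [h + 1] is shrunk by [h / (h + 1)] to level [h], moving by at most
    [1 / K <= e / 2], and is rounded there with error [e / 2]; the result is zero or lies in an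
    earlier block. *)
Lemma dense_labels_ex k (e : R) : 0 < e -> exists al : seq 'cV[R]_k,
  [/\ forall i, delta_mx i 0 \in al, forall y, y \in al -> l1 y <= 1 &
   dense_labels al e].
Proof.
move=> e0; have e20 : 0 < e / 2 by rewrite divr_gt0.
have [D [hD1 hD2 hD3]] := l1_net k e20.
pose K := (Num.truncn (e / 2)^-1).+1.
have K0 : 0 < K%:R :> R by rewrite ltr0n.
have hK : K%:R^-1 <= e / 2.
  by rewrite -[leRHS]invrK lef_pV2 ?posrE ?invr_gt0 // ltW // truncnS_gt.
pose lev h : R := h%:R / K%:R.
have lev0 h : 0 <= lev h by rewrite divr_ge0 ?ler0n // ltW.
pose al h := [seq lev i.+1 *: y | i <- iota 0 h, y <- D].
have alS h : al h.+1 = al h ++ [seq lev h.+1 *: y | y <- D].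
  by rewrite /al -[h.+1]addn1 iotaD map_cat flatten_cat /= cats0 add0n addn1.
have levle h : (h <= K)%N -> lev h <= 1.
  by move=> hk; rewrite ler_pdivrMr // mul1r ler_nat.
have H h : (h <= K)%N -> (forall x, l1 x <= lev h ->
      exists2 y, (y <= size (al h))%N & l1 (x - label (al h) y) <= e / 2) /\
    dense_labels (al h) e.
  elim: h => [_|h IH hK'].
    split=> // x; rewrite /lev mul0r => x0; exists 0%N => //.
    by rewrite /label /= subr0; apply: le_trans x0 (ltW e20).
  have [IH1 IH2] := IH (ltnW hK').
  have levS : 0 < lev h.+1 by rewrite divr_gt0 ?ltr0n.
  rewrite alS; split=> [x hx|t].
    have [|y yD hy] := hD3 ((lev h.+1)^-1 *: x).
      by rewrite l1Z gtr0_norm ?invr_gt0 // mulrC ler_pdivrMr // mul1r.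
    exists (size (al h) + (index y D).+1)%N.
      by rewrite size_cat size_map leq_add2l index_mem.
    have -> : label (al h ++ [seq lev h.+1 *: y | y <- D])
        (size (al h) + (index y D).+1) = lev h.+1 *: y.
      rewrite /label addnS /= nth_cat ltnNge leq_addr /= addKn.
      by rewrite (nth_map 0) ?index_mem // nth_index.
    have -> : x - lev h.+1 *: y = lev h.+1 *: ((lev h.+1)^-1 *: x - y).
      by rewrite scalerBr scalerA divff ?gt_eqF // scale1r.
    rewrite l1Z gtr0_norm //; apply: le_trans hy; rewrite -[leRHS]mul1r.
    by rewrite ler_wpM2r ?l1_ge0 ?levle.
  rewrite size_cat size_map => tlt x; rewrite nth_cat.
  case: ltnP => [th /(IH2 _ th)[y yt hy]|th].
    by exists y => //; rewrite label_cat // (leq_trans yt) // ltnW.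
  rewrite (nth_map 0) ?ltn_subLR // => hx.
  have {}hx : l1 x <= lev h.+1.
    apply: le_trans hx _; rewrite l1Z gtr0_norm // -[leRHS]mulr1 ler_pM2l //.
    by apply/hD2/mem_nth; rewrite ltn_subLR.
  pose u : R := h%:R / h.+1%:R.
  have u1 : 1 - u = h.+1%:R^-1.
    by rewrite /u -natr1; field; rewrite natr1 pnatr_eq0.
  have [|y yh hy] := IH1 (u *: x).
    rewrite l1Z ger0_norm ?divr_ge0 //; apply: le_trans (ler_wpM2l _ hx) _.
      by rewrite divr_ge0.
    by rewrite /lev /u mulrA divfK // pnatr_eq0.
  exists y; first exact: leq_trans yh th.
  rewrite label_cat // -[x](subrK (u *: x)) -addrA.
  apply: le_trans (l1D _ _) _; rewrite [e]splitr; apply: lerD hy.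
  rewrite -{1}[x]scale1r -scalerBl u1 l1Z ger0_norm ?invr_ge0 //.
  apply: le_trans hK; rewrite mulrC ler_pdivrMr ?ltr0n // mulrC.
  exact: hx.
have mem h y : y \in al h -> exists i z, [/\ (i < h)%N, z \in D & y = lev i.+1 *: z].
  move=> /allpairsP[[i z] /= [+ zD ->]]; rewrite mem_iota => /andP[_ ih].
  by exists i, z.
exists (al K); split.
- move=> i; have -> : al K = al (K.-1).+1 by [].
  rewrite alS mem_cat; apply/orP; right; apply/mapP; exists (delta_mx i 0) => //.
  by rewrite /lev prednK // divff ?scale1r // gt_eqF.
- move=> _ /mem[i [z [iK zD ->]]]; rewrite l1Z ger0_norm //.
  by apply: mulr_ile1; rewrite ?l1_ge0 ?hD2 ?levle.
- by have [] := H K (leqnn K).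
Qed.

(* An embedding is a map from the columns to the unit ball of l1 hitting all unit
   vectors up to sign, approximated by a word of labels. Position [(t, f)] of the
   intermediate space is the vector [q t f], the image of the label [al_t] under
   the signed map [f] of unit vectors; the embedding [A] maps it to a vector
   of norm at most that of [al_t], which is [al_t] for a suitable [f] and otherwise
   is rounded to an earlier label, so that the resulting word is rigid. *)
Lemma linf_ramsey d m r (e : R) : (0 < d)%N -> 0 < e ->
  exists n, forall c : 'M[R]_(d, n) -> 'I_r, exists T : 'M[R]_(m, n),
    isEmb (@linf R m) (@linf R n) T /\
    exists i, forall A, isEmb (@linf R d) (@linf R m) A ->
      exists B, [/\ isEmb (@linf R d) (@linf R n) B, c B = i &
        opbnd (@linf R d) (@linf R n) (A *m T - B) e].
Proof.
move=> d0 e0; have [al [al1 al2 al3]] := dense_labels_ex d e0.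
pose X : finType := {ffun 'I_d -> 'I_m * bool}.
pose q (t : nat) (f : X) : 'cV[R]_m :=
  \sum_i ((-1) ^+ (f i).2 * nth 0 al t i 0) *: delta_mx (f i).1 0.
pose PL := [seq (t, f) | t <- iota 0 (size al), f <- enum X].
have PLlt x : x \in PL -> (x.1 < size al)%N.
  by move=> /allpairsP[[t f] /= [+ _ ->]]; rewrite mem_iota.
pose ql := [seq q x.1 x.2 | x <- PL].
have ql1 t f : l1 (q t f) <= l1 (nth 0 al t).
  apply: le_trans (l1_sum _ _ _) _; apply: ler_sum => i _.
  by rewrite l1Z l1_delta mulr1 normrM normrX normrN1 expr1n mul1r.
have al2' t : l1 (nth 0 al t) <= 1.
  have [tl|tl] := ltnP t (size al); first exact/al2/mem_nth.
  by rewrite nth_default // l1_0.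
(* The only constant is the letter 0, the zero vector. The labels are the parameters of the colored
   words, the pairs [(t, f)] those of the intermediate word. *)
have [n hn] := @GrahamRothschild 1 (size al) isT (size PL) ('I_r : finType).
exists n => c.
pose mx (w : seq nat) : 'M[R]_(d, n) := \matrix_(i, p) label al (nth 0%N w p) i 0.
have col_mx w p : col p (mx w) = label al (nth 0%N w p).
  by apply/matrixP => i j; rewrite !mxE (ord1 j).
have [sig [i [ssig rsig hsig]]] := hn (fun w => c (mx w)).
pose T : 'M[R]_(m, n) := \matrix_(j, p) label ql (nth 0%N sig p) j 0.
have col_T p : col p T = label ql (nth 0%N sig p).
  by apply/matrixP => i' j; rewrite !mxE (ord1 j).
have label1 k (s : seq 'cV[R]_k) y : (forall z, z \in s -> l1 z <= 1) ->
    l1 (label s y) <= 1.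
  move=> h; case: y => [|y]; rewrite /label /=; first by rewrite l1_0.
  have [yl|yl] := ltnP y (size s); first exact/h/mem_nth.
  by rewrite nth_default // l1_0.
have occurs w y : y \in w -> size w = n -> exists p : 'I_n, nth 0%N w p = y.
  move=> yw sw; have yn : (index y w < n)%N by rewrite -sw index_mem.
  by exists (Ordinal yn); rewrite /= nth_index.
exists T; split.
  apply: linf_isEmb => [p|j].
    rewrite col_T; apply: label1 => z /mapP[x _ ->].
    exact: le_trans (ql1 _ _) (al2' _).
  (* A label that is a unit vector, under the constant map to [j], gives the [j]-th unit vector of
     linf^m; this needs [d > 0]. *)
  pose i0 : 'I_d := Ordinal d0; pose t := index (delta_mx i0 0) al.
  have tl : (t < size al)%N by rewrite index_mem al1.
  pose f : X := [ffun=> (j, false)].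
  have qE : q t f = delta_mx j 0.
    rewrite /q /t nth_index ?al1 // (bigD1 i0) //= big1 ?addr0.
      by rewrite ffunE mxE !eqxx mulr1 expr0 scale1r.
    by move=> i' /negbTE ni; rewrite mxE ni mulr0 scale0r.
  have xP : (t, f) \in PL.
    by apply/allpairsP; exists (t, f); rewrite mem_iota mem_enum.
  have /occurs[//|p hp] : (1 + index (t, f) PL)%N \in sig.
    by apply: rigid_mem rsig _; rewrite index_mem.
  exists p, false; rewrite expr0 scale1r col_T hp /label /=.
  by rewrite (nth_map (0%N, f)) ?index_mem // nth_index.
exists i => A hA.
have A1 p : l1 (col p A) <= 1 by apply: linf_opbnd_col => //; exact: isEmb_opbnd.
(* A label that is hit exactly must be kept, as it supplies the letter [t + 1] in pass [t]; in all
   other cases the letter is at most [t]. *)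
have /choice[g hg] : forall x : nat * X, exists y, (x.1 < size al)%N ->
    [/\ (y <= x.1.+1)%N, l1 (A *m q x.1 x.2 - label al y) <= e &
     A *m q x.1 x.2 = nth 0 al x.1 -> y = x.1.+1].
  move=> [t f] /=; have [tl|tl] := ltnP t (size al); last by exists 0%N.
  have [hq|hq] := pselect (A *m q t f = nth 0 al t).
    by exists t.+1 => _; split=> //; rewrite hq /label /= subrr l1_0 ltW.
  have [|y yt hy] := al3 t tl (A *m q t f).
    exact: le_trans (l1_mulmx _ A1) (ql1 _ _).
  by exists y => _; split=> //; exact: leqW.
pose tau := map g PL.
have rtau : rigid 1 (size al) tau.
  have -> : tau = [seq g (t, f) | t <- iota 0 (size al), f <- enum X].
    by rewrite /tau map_allpairs.
  apply: rigid_passes => [t f tl _|t tl]; first by have [] := hg (t, f) tl.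
  (* [f] follows the columns of [A] that are signed unit vectors. The signs in [q t f] cancel those
     of the columns, so [A] maps it to the label itself. *)
  have /choice[pb hpb] : forall i, exists pb : 'I_m * bool,
      col pb.1 A = (-1) ^+ pb.2 *: delta_mx i 0.
    by move=> i'; have [p [b h]] := linf_isEmb_unit_col i' hA; exists (p, b).
  pose f : X := [ffun i => pb i].
  exists f; first by rewrite mem_enum.
  have [_ _ -> //] := hg (t, f) tl; rewrite /= /q mulmx_sumr.
  rewrite [RHS]matrix_sum_delta; apply: eq_bigr => i' _.
  rewrite big_ord1 -scalemxAr -colE ffunE hpb scalerA mulrAC.
  by rewrite -signr_addb addbb mul1r.
have staul : size tau = size PL by rewrite size_map.
have rB : rigid 1 (size al) (wsubst (iota 0 1 ++ tau) sig).
  by apply: rigid_wsubst; rewrite ?staul.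
exists (mx (wsubst (iota 0 1 ++ tau) sig)); split; last first.
- apply: opbnd_linf => [|p]; first exact: ltW.
  rewrite linearB /= col_mx (_ : col p (A *m T) = A *m col p T); last first.
    by rewrite !colE mulmxA.
  rewrite col_T (nth_map 0%N) ?ssig //.
  have := allP (rigid_bound rsig) (nth 0%N sig p); rewrite mem_nth ?ssig // => /(_ isT).
  case: (nth 0%N sig p) => [_|y]; first by rewrite /label /= mulmx0 subrr l1_0 ltW.
  rewrite add1n ltnS => yl.
  have [x0 _] : exists x, x \in PL.
    by case: (PL) yl => // x0 s _; exists x0; rewrite mem_head.
  have -> : nth 0%N (iota 0 1 ++ tau) y.+1 = g (nth x0 PL y) by exact: nth_map.
  have -> : label ql y.+1 = q (nth x0 PL y).1 (nth x0 PL y).2 by exact: nth_map.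
  by have [] := hg (nth x0 PL y) (PLlt _ (mem_nth x0 yl)).
- exact: hsig.
apply: linf_isEmb => [p|j]; first by rewrite col_mx; exact: label1.
have jt : (index (delta_mx j 0)%R al < size al)%N by rewrite index_mem.
have /occurs[|p hp] := rigid_mem rB jt; first by rewrite size_wsubst.
exists p, false; rewrite expr0 scale1r col_mx hp /label /=.
by rewrite nth_index.
Qed.

End Linf.

(** * Polyhedral spaces *)

Section Polyhedral.
Variable R : realType.

Lemma col_mulmx k l n (A : 'M[R]_(k, l)) (B : 'M[R]_(l, n)) p :
  col p (A *m B) = A *m col p B.
Proof. by rewrite !colE mulmxA. Qed.

Definition dualball k (N : 'rV[R]_k -> R) : set 'rV[R]_k :=
  [set f | forall x : 'rV_k, (x *m f^T) 0 0 <= N x].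

Lemma mul_trE k (x f : 'rV[R]_k) : (x *m f^T) 0 0 = \sum_i x 0 i * f 0 i.
Proof. by rewrite mxE; apply: eq_bigr => i _; rewrite mxE. Qed.

Lemma dualballE k (N : 'rV[R]_k -> R) : is_norm N -> ball1 (dualnorm N) = dualball N.
Proof.
move=> hN; apply/seteqP; split=> f /= hf; last first.
  apply: ge_sup.
    by exists (\sum_i (0 : 'rV[R]_k) 0 i * f 0 i), 0 => //=; rewrite is_norm0.
  by move=> _ [x /= x1 <-]; rewrite -mul_trE (le_trans (hf x)).
move=> x; have [->|x0] := eqVneq x 0; first by rewrite mul0mx mxE is_norm0.
have Nx := is_norm_gt0 hN x0.
rewrite -[leRHS]mulr1 -ler_pdivrMl //.
have -> : (N x)^-1 * (x *m f^T) 0 0 = \sum_i ((N x)^-1 *: x) 0 i * f 0 i.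
  by rewrite -mul_trE -scalemxAl [RHS]mxE.
apply: le_trans hf; apply: ub_le_sup; last first.
  by exists ((N x)^-1 *: x) => //=; rewrite is_normZ // gtr0_norm ?invr_gt0 // mulVf // gt_eqF.
have [C C0 hC] := opbnd_ex hN (linf_norm R 1) f^T.
exists C => _ [y /= y1 <-]; rewrite -mul_trE; apply: le_trans (ler_norm _) _.
apply: le_trans (ler_linf (y *m f^T) 0) _; apply: le_trans (hC y) _.
by rewrite -[leRHS]mulr1 ler_wpM2l.
Qed.

Lemma closed_linfP k (K : set 'rV[R]_k) :
  (forall f, (forall e, 0 < e -> exists2 g, K g & linf (f - g) <= e) -> K f) ->
  closed K.
Proof.
move=> h f clf; apply: h => e e0.
have /(_ (nbhsx_ballx f e e0))[g [Kg]] := clf (ball f e).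
rewrite mx_norm_ball /ball_ /= => fg; exists g => //.
by rewrite linf_mx_norm ltW.
Qed.

Lemma closed_linf k (K : set 'rV[R]_k) f : closed K ->
  (forall e, 0 < e -> exists2 g, K g & linf (f - g) <= e) -> K f.
Proof.
move=> cK h; apply: cK => B /(@nbhs_ballP R 'rV[R]_k)[e /= e0 hB].
have [|g Kg fg] := h (e / 2); first by rewrite divr_gt0.
exists g; split=> //; apply: hB; rewrite mx_norm_ball /ball_ /= -linf_mx_norm.
by apply: le_lt_trans fg _; rewrite ltr_pdivrMr // ltr_pMr // ltr1n.
Qed.

Lemma le_eps (a b c : R) : 0 <= c -> (forall e, 0 < e -> a <= b + c * e) -> a <= b.
Proof.
move=> c0 h; rewrite leNgt; apply/negP => ba.
have c1 : 0 < c + 1 by rewrite ltr_wpDl.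
have := h ((a - b) / (c + 1)); rewrite divr_gt0 ?subr_gt0 // => /(_ isT).
rewrite -lerBlDl mulrA ler_pdivlMr // mulrC; apply/negP; rewrite -ltNge.
by rewrite ltr_pM2r ?subr_gt0 // ltrDl.
Qed.

Definition face k (K F : set 'rV[R]_k) := F `<=` K /\
  forall f y z t, F f -> K y -> K z -> 0 < t -> t < 1 -> f = t *: y + (1 - t) *: z ->
    F y /\ F z.

Lemma convex_max (y z M t : R) : 0 < t -> t < 1 -> y <= M -> z <= M ->
  M = t * y + (1 - t) * z -> y = M /\ z = M.
Proof. by move=> t0 t1 yM zM e; split; apply/eqP; rewrite eq_le ?yM ?zM /=; nra. Qed.

(* The extreme point is found by successively maximizing the coordinates. *)
Lemma extreme_point_ex k (K : set 'rV[R]_k) M : K !=set0 -> closed K ->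
  (forall f, K f -> linf f <= M) -> exists f, extreme_point K f.
Proof.
move=> K0 cK bK.
have : forall s : seq 'I_k, exists F, [/\ F !=set0, closed F, face K F &
    forall f g i, F f -> F g -> i \in s -> f 0 i = g 0 i].
  elim=> [|i s [F [F0 cF [FK hF] eF]]].
    by exists K; split=> //; split.
  have cmpF : compact F by apply: (@linf_bounded_compact _ _ _ M cF) => f /FK/bK.
  have ci : {within F, continuous (fun f : 'rV[R]_k => f 0 i)}.
    by apply: continuous_subspaceT => x; exact: coord_continuous.
  have [m mF maxm] := EVT_max_rV F0 cmpF ci; rewrite inE in mF.
  exists (F `&` [set f | f 0 i = m 0 i]); split.
  - by exists m.
  - apply: closed_linfP => f hf; split.
      by apply: closed_linf cF _ => e /hf[g [Fg _] fg]; exists g.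
    apply/eqP; rewrite -subr_eq0 -normr_le0; apply: (@le_eps _ _ 1) => // e e0.
    have [g [_ /= <-] fg] := hf e e0.
    by rewrite add0r mul1r (le_trans _ fg) //; have := ler_linf (f - g) i; rewrite !mxE.
  - split=> [f [/FK]//|f y z t [Ff /= fm] Ky Kz t0 t1 e].
    have [Fy Fz] := hF f y z t Ff Ky Kz t0 t1 e.
    have := maxm y (mem_set Fy) => ym; have := maxm z (mem_set Fz) => zm.
    have [|hy hz] := convex_max t0 t1 ym zm; last by split; split.
    by rewrite -fm e !mxE.
  - move=> f g j [Ff /= fm] [Fg /= gm]; rewrite inE => /orP[/eqP ->|].
      by rewrite fm.
    exact: eF.
move=> /(_ (enum 'I_k))[F [[f Ff] _ [FK hF] eF]]; exists f; split; first exact: FK.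
move=> y z t Ky Kz t0 t1 e; have [Fy Fz] := hF f y z t Ff Ky Kz t0 t1 e.
by apply/rowP => i; apply: eF => //; rewrite mem_enum.
Qed.

Lemma face_extreme_point k (K F : set 'rV[R]_k) f : face K F ->
  extreme_point F f -> extreme_point K f.
Proof.
move=> [FK hF] [Ff ef]; split=> [|y z t Ky Kz t0 t1 e]; first exact: FK.
have [Fy Fz] := hF f y z t Ff Ky Kz t0 t1 e.
exact: (ef y z t).
Qed.

Lemma dualball_bounded k (N : 'rV[R]_k -> R) : is_norm N ->
  exists M, forall f, dualball N f -> linf f <= M.
Proof.
move=> hN; have [C C0 hC] := norm_le_linf hN; exists C => f hf.
have d1 i : linf (delta_mx 0 i : 'rV[R]_k) <= 1.
  by apply: linf_le => // j; rewrite mxE; case: (_ && _); rewrite ?normr1 ?normr0.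
have fi i : f 0 i = ((delta_mx 0 i : 'rV[R]_k) *m f^T) 0 0 by rewrite -rowE !mxE.
have Nd i : N (delta_mx 0 i) <= C.
  by apply: le_trans (hC _) _; rewrite -[leRHS]mulr1 ler_pM2l.
apply: linf_le => [|i]; first exact: ltW.
rewrite ler_norml fi lerNl (le_trans (hf _)) // andbT.
have := hf (- delta_mx 0 i); rewrite mulNmx [X in X <= _]mxE => /le_trans; apply.
by rewrite is_normN.
Qed.

Lemma mulmx_linf_le k (x f g : 'rV[R]_k) :
  (x *m f^T) 0 0 <= (x *m g^T) 0 0 + l1 x^T * linf (f - g).
Proof.
rewrite -lerBlDl -[X in X <= _]/(_ + _) -[- _ in X in X <= _]mulN1r.
have -> : (x *m f^T) 0 0 + -1 * (x *m g^T) 0 0 = (x *m (f - g)^T) 0 0.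
  by rewrite mulN1r linearB /= mulmxBr !mxE.
rewrite mul_trE mulr_suml; apply: ler_sum => i _.
apply: le_trans (ler_norm _) _; rewrite normrM [x^T i 0]mxE.
by rewrite ler_wpM2l // ler_linf.
Qed.

Lemma dualball_closed k (N : 'rV[R]_k -> R) : closed (dualball N).
Proof.
apply: closed_linfP => f hf x; apply: (le_eps (l1_ge0 x^T)) => e e0.
have [g gN fg] := hf e e0; apply: le_trans (mulmx_linf_le x f g) _.
by rewrite lerD ?gN // ler_wpM2l // l1_ge0.
Qed.

Lemma dualball_face_ex k (N : 'rV[R]_k -> R) (F : set 'rV[R]_k) : is_norm N ->
  face (dualball N) F -> F !=set0 -> closed F ->
  exists2 f, F f & extreme_point (dualball N) f.
Proof.
move=> hN hF F0 cF; have [M hM] := dualball_bounded hN.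
have [|f ef] := extreme_point_ex (M := M) F0 cF.
  by move=> f /(proj1 hF)/hM.
by exists f; [case: ef | exact: face_extreme_point ef].
Qed.

Lemma norm_hahn_banach k l (N : 'rV[R]_l -> R) (A : 'M[R]_(k, l)) (f : 'cV[R]_k) :
  is_norm N -> (forall x : 'rV_k, (x *m f) 0 0 <= N (x *m A)) ->
  exists g : 'rV[R]_l, A *m g^T = f /\ dualball N g.
Proof.
move=> hN hf; have [||g [hg1 hg2]] := hahn_banach (p := N) _ _ hf.
- exact: is_normD.
- by move=> a x a0; rewrite is_normZ // ger0_norm.
by exists g^T; rewrite trmxK; split=> // x; rewrite trmxK.
Qed.

Lemma norming_functional k (N : 'rV[R]_k -> R) (x : 'rV[R]_k) : is_norm N ->
  exists2 f, dualball N f & (x *m f^T) 0 0 = N x.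
Proof.
move=> hN; have [|f [hf1 hf2]] := norm_hahn_banach (A := x) (f := (N x)%:M) hN.
  move=> y; rewrite mul_mx_scalar {2}[y]mx11_scalar mul_scalar_mx is_normZ //.
  by rewrite mxE mulrC ler_wpM2r ?ler_norm // is_norm_ge0.
by exists f => //; rewrite hf1 mxE eqxx mulr1n.
Qed.

(** The functionals norming [x] form a closed face of the dual ball, nonempty by Hahn-Banach, and a
    point extreme in a face is extreme in the ball. *)
Lemma norming_extreme k (N : 'rV[R]_k -> R) (x : 'rV[R]_k) : is_norm N ->
  exists2 f, extreme_point (dualball N) f & (x *m f^T) 0 0 = N x.
Proof.
move=> hN; pose F := dualball N `&` [set f | (x *m f^T) 0 0 = N x].
have [|||f [_ hf] ef] := @dualball_face_ex _ N F hN; last by exists f.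
- split=> [f []//|f y z t [bf /= hf] by_ bz t0 t1 e].
  have [|hy hz] := convex_max t0 t1 (by_ x) (bz x); last by split; split.
  by rewrite -hf e linearD /= !linearZ /= mulmxDr -!scalemxAr !mxE.
- by have [f hf fx] := norming_functional x hN; exists f.
- apply: closed_linfP => f hf.
  have bf : dualball N f.
    by apply: (closed_linf (@dualball_closed _ N)) => e /hf[g [gN _] fg]; exists g.
  split=> //=; apply/eqP; rewrite eq_le bf /=.
  apply: (le_eps (l1_ge0 x^T)) => e e0; have [g [gN /= <-] fg] := hf e e0.
  apply: le_trans (mulmx_linf_le x g f) _; rewrite lerD2l ler_wpM2l ?l1_ge0 //.
  by rewrite (is_normBC (linf_norm R k)).
Qed.

Lemma dualballN k (N : 'rV[R]_k -> R) f : is_norm N -> dualball N f -> dualball N (- f).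
Proof.
move=> hN hf x; rewrite linearN /= mulmxN -mulNmx -(is_normN hN x); exact: hf.
Qed.

Lemma extremeN k (N : 'rV[R]_k -> R) f : is_norm N ->
  extreme_point (dualball N) f -> extreme_point (dualball N) (- f).
Proof.
move=> hN [bf ef]; split=> [|y z t by_ bz t0 t1 e]; first exact: dualballN.
apply: oppr_inj; apply: (ef _ _ t); rewrite ?scalerN -?opprD -?e ?opprK //;
  exact: dualballN.
Qed.

(** * Frames of extreme functionals and the existence of n_pol *)

Lemma half_seq (V : zmodType) (s : seq V) d : uniq s -> size s = (2 * d)%N ->
  (forall x, x \in s -> - x \in s) -> (forall x, x \in s -> x != - x) ->
  exists t, [/\ size t = d, uniq t, {subset t <= s},
    (forall x, x \in s -> x \in t \/ - x \in t) &
    forall x y, x \in t -> y \in t -> x <> - y].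
Proof.
move=> us ss sN sn; pose t := [seq x <- s | (index x s < index (- x) s)%N].
have ts x : x \in t -> x \in s by rewrite mem_filter => /andP[].
have tN x : x \in s -> x \in t \/ - x \in t.
  move=> xs; rewrite !mem_filter opprK xs sN //= !andbT.
  case: ltngtP => [_|_|e]; [by left|by right|].
  by have := sn x xs; rewrite -{1}(nth_index 0 xs) e nth_index ?sN // eqxx.
have ttN x y : x \in t -> y \in t -> x <> - y.
  move=> + + e; rewrite !mem_filter e opprK => /andP[h1 _] /andP[h2 _].
  by have := ltn_trans h1 h2; rewrite ltnn.
have ut : uniq t by exact: filter_uniq.
exists t; split=> //; apply/eqP; rewrite -(eqn_pmul2l (isT : (0 < 2)%N)) -ss mul2n -addnn.
rewrite -{2}(size_map -%R) -size_cat; apply/eqP/perm_size/uniq_perm => //.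
  have uN : uniq [seq - x | x <- t] by rewrite map_inj_uniq //; exact: oppr_inj.
  rewrite cat_uniq ut uN andbT /=.
  by apply/hasPn => _ /mapP[y yt ->]; apply/negP => /ttN/(_ yt).
move=> x; rewrite mem_cat; apply/idP/idP => [/orP[/ts//|/mapP[y /ts/sN + ->] //]|].
move=> /tN[->//|h]; apply/orP; right; apply/mapP; exists (- x) => //.
by rewrite opprK.
Qed.

Lemma in_Pol_frame d k (N : 'rV[R]_k -> R) : (0 < d)%N -> in_Pol d N ->
  exists t : 'I_d -> 'rV[R]_k, [/\ forall i, extreme_point (dualball N) (t i),
    forall f, extreme_point (dualball N) f -> exists i (b : bool), t i = (-1) ^+ b *: f &
    forall i j (b c : bool), (-1) ^+ b *: t i = (-1) ^+ c *: t j -> i = j /\ b = c].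
Proof.
move=> d0 [hN _ [s [us ss hs]]]; rewrite dualballE // in hs.
have [|x xs|t [st ut ts tN ttN]] := half_seq us ss.
- by move=> x /hs/(extremeN hN)/hs.
(* An extreme point [x = - x] is zero, and if zero is extreme the dual ball is trivial. Then there
   is at most one extreme point, against [2 * d] with [d > 0]. *)
- apply/eqP => xN.
  have x0 : x = 0.
    by apply/eqP; have := xN => /eqP; rewrite -addr_eq0 -mulr2n -scaler_nat scaler_eq0
      pnatr_eq0.
  have /hs[b0 e0] := xs.
  have all0 y : dualball N y -> y = 0.
    move=> hy; have /eqP : y = - y.
      apply: (e0 y (- y) 2^-1 hy (dualballN hN hy)); [lra|lra|].
      by rewrite x0 scalerN -scalerBl (_ : 2^-1 - (1 - 2^-1) = 0) ?scale0r //; lra.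
    by rewrite -addr_eq0 -mulr2n -scaler_nat scaler_eq0 pnatr_eq0 => /eqP.
  have : (size s <= 1)%N.
    apply: (@uniq_leq_size _ s [:: 0]) => // y /hs[by_ _].
    by rewrite inE (all0 y by_).
  by rewrite ss; case: (d) d0 => // d' _; rewrite mulnS.
exists (fun i => nth 0 t i).
have it (i : 'I_d) : nth 0 t i \in t by rewrite mem_nth // st.
split=> [i|f /hs/tN[ft|ft]|i j b c].
- exact/hs/ts/it.
- have fd : (index f t < d)%N by rewrite -st index_mem.
  by exists (Ordinal fd), false; rewrite /= expr0 scale1r nth_index.
- have fd : (index (- f) t < d)%N by rewrite -st index_mem.
  by exists (Ordinal fd), true; rewrite /= expr1 scaleN1r nth_index.
- have inj : nth 0 t i = nth 0 t j -> i = j.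
    by move=> /eqP; rewrite nth_uniq ?st // => /eqP/val_inj.
  case: b; case: c; rewrite ?expr0 ?expr1 ?scale1r ?scaleN1r.
  + by move=> /oppr_inj/inj.
  + by move=> /esym/ttN; case.
  + by move=> /ttN; case.
  + by move=> /inj.
Qed.

Lemma dualball_l1 k (w : 'rV[R]_k) : dualball (@linf R k) w -> l1 w^T <= 1.
Proof.
move=> h; have hw : opbnd (@linf R k) (@linf R 1) w^T 1.
  move=> x; rewrite mul1r; apply: linf_le => [|i]; first exact: linf_ge0.
  rewrite (ord1 i) ler_norml (h x) andbT lerNl.
  by have := h (- x); rewrite mulNmx [X in X <= _]mxE (is_normN (linf_norm R k)).
by have := linf_opbnd_col ord0 ler01 hw; rewrite col_id.
Qed.

Lemma l1_dualball k (w : 'rV[R]_k) : l1 w^T <= 1 -> dualball (@linf R k) w.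
Proof.
move=> h x; rewrite mul_trE; apply: le_trans (ler_norm _) _.
apply: le_trans (ler_norm_sum _ _ _) _; rewrite -[leRHS]mul1r.
apply: le_trans (ler_wpM2r (linf_ge0 x) h); rewrite mulr_suml.
by apply: ler_sum => i _; rewrite normrM mulrC mxE ler_wpM2l // ler_linf.
Qed.

Definition frame_mx d k (t : 'I_d -> 'rV[R]_k) : 'M[R]_(k, d) :=
  \matrix_(x, j) t j 0 x.

Lemma col_frame_mx d k (t : 'I_d -> 'rV[R]_k) j : col j (frame_mx t) = (t j)^T.
Proof. by apply/matrixP => x y; rewrite !mxE (ord1 y). Qed.

Lemma mulmx_frame d k (t : 'I_d -> 'rV[R]_k) (x : 'rV[R]_k) j :
  (x *m frame_mx t) 0 j = (x *m (t j)^T) 0 0.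
Proof. by rewrite !mxE; apply: eq_bigr => i _; rewrite !mxE. Qed.

Lemma frame_isEmb d k (N : 'rV[R]_k -> R) (t : 'I_d -> 'rV[R]_k) : is_norm N ->
  (forall i, extreme_point (dualball N) (t i)) ->
  (forall f, extreme_point (dualball N) f ->
     exists i (b : bool), t i = (-1) ^+ b *: f) ->
  isEmb N (@linf R d) (frame_mx t).
Proof.
move=> hN te ht x; apply/eqP; rewrite eq_le; apply/andP; split.
  apply: linf_le => [|j]; first exact: is_norm_ge0.
  have [bt _] := te j; rewrite mulmx_frame ler_norml bt andbT lerNl.
  by have := dualballN hN bt x; rewrite linearN mulmxN [X in X <= _]mxE.
have [f /ht[i [b tf]] <-] := norming_extreme x hN.
apply: le_trans (ler_linf _ i); rewrite mulmx_frame tf linearZ /= -scalemxAr [X in `|X|]mxE.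
by rewrite normrM normrX normrN1 expr1n mul1r ler_norm.
Qed.

(** The extensions of [f] along [h] form a face: splitting an extension splits [f], which is
    possible only trivially. Hahn-Banach makes this face nonempty, and being closed and bounded it
    has an extreme point. *)
Lemma extreme_extension k l (NF : 'rV[R]_k -> R) (NG : 'rV[R]_l -> R)
    (h : 'M[R]_(k, l)) f : is_norm NF -> is_norm NG -> isEmb NF NG h ->
  extreme_point (dualball NF) f ->
  exists2 g, extreme_point (dualball NG) g & h *m g^T = f^T.
Proof.
move=> hF hG hh [bf ef]; pose F := dualball NG `&` [set g | h *m g^T = f^T].
have pull g : dualball NG g -> dualball NF (h *m g^T)^T.
  by move=> hg x; rewrite trmxK mulmxA -hh; exact: hg.
have [|||g [_ hg] eg] := @dualball_face_ex _ NG F hG; last by exists g.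
- split=> [g []//|g y z t [bg /= hg] by_ bz t0 t1 e].
  have et : f = t *: (h *m y^T)^T + (1 - t) *: (h *m z^T)^T.
    apply: trmx_inj; rewrite [RHS]linearD /= ![(_ *: _^T)^T]linearZ /= !trmxK.
    by rewrite -hg e linearD /= !linearZ /= mulmxDr -!scalemxAr.
  have eyz := ef _ _ t (pull _ by_) (pull _ bz) t0 t1 et.
  have ef1 : f = (h *m y^T)^T.
    by rewrite et eyz -scalerDl addrC subrK scale1r.
  split; split=> //=; apply: trmx_inj; first by rewrite trmxK.
  by rewrite -eyz trmxK.
- have [|g [hg1 hg2]] := norm_hahn_banach (A := h) (f := f^T) hG.
    by move=> x; rewrite hh; exact: bf.
  by exists g.
- apply: closed_linfP => g hg.
  have bg : dualball NG g.
    by apply: (closed_linf (@dualball_closed _ NG)) => e /hg[g' [gN _] fg]; exists g'.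
  split=> //=; apply/matrixP => i j; rewrite (ord1 j).
  have rowe (u : 'cV[R]_l) : (h *m u) i 0 = (row i h *m u) 0 0.
    by rewrite -row_mul [RHS]mxE.
  have close e : 0 < e -> exists2 g' : 'rV_l, (row i h *m g'^T) 0 0 = f^T i 0 &
      linf (g - g') <= e.
    by move=> /hg[g' [_ /= <-] gg]; exists g' => //; rewrite rowe.
  rewrite rowe; apply/eqP; rewrite eq_le; apply/andP; split.
    apply: (le_eps (l1_ge0 (row i h)^T)) => e /close[g' <- gg].
    by apply: le_trans (mulmx_linf_le _ g g') _; rewrite lerD2l ler_wpM2l ?l1_ge0.
  apply: (le_eps (l1_ge0 (row i h)^T)) => e /close[g' <- gg].
  apply: le_trans (mulmx_linf_le _ g' g) _; rewrite lerD2l ler_wpM2l ?l1_ge0 //.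
  by rewrite (is_normBC (linf_norm R l)).
Qed.

(** Column [p] of [A] writes the restriction of [tG p] along [h] as a combination of the [tF i] of
    l1 norm at most one, by Hahn-Banach along [frame_mx tF]. If the restriction is a signed [tF i],
    the signed unit vector is chosen; by [extreme_extension] this happens for every [i], so [A] is
    isometric. *)
Lemma frame_extension d m k l (NF : 'rV[R]_k -> R) (NG : 'rV[R]_l -> R)
    (tF : 'I_d -> 'rV[R]_k) (tG : 'I_m -> 'rV[R]_l) (h : 'M[R]_(k, l)) :
  is_norm NF -> is_norm NG ->
  (forall i, extreme_point (dualball NF) (tF i)) ->
  (forall f, extreme_point (dualball NF) f ->
     exists i (b : bool), tF i = (-1) ^+ b *: f) ->
  (forall i j (b c : bool), (-1) ^+ b *: tF i = (-1) ^+ c *: tF j -> i = j /\ b = c) ->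
  (forall i, extreme_point (dualball NG) (tG i)) ->
  (forall f, extreme_point (dualball NG) f ->
     exists i (b : bool), tG i = (-1) ^+ b *: f) ->
  isEmb NF NG h ->
  exists2 A, isEmb (@linf R d) (@linf R m) A & frame_mx tF *m A = h *m frame_mx tG.
Proof.
move=> hF hG F1 F2 F3 G1 G2 hh.
have embF := frame_isEmb hF F1 F2.
have /choice[w hw] : forall p, exists w : 'cV[R]_d,
    [/\ l1 w <= 1, frame_mx tF *m w = h *m (tG p)^T &
     forall i (b : bool), h *m (tG p)^T = (-1) ^+ b *: (tF i)^T ->
       w = (-1) ^+ b *: delta_mx i 0].
  move=> p.
  have [[i [b e]]|ne] :=
      pselect (exists i (b : bool), h *m (tG p)^T = (-1) ^+ b *: (tF i)^T).
    exists ((-1) ^+ b *: delta_mx i 0); split.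
    - by rewrite l1Z l1_delta mulr1 normrX normrN1 expr1n.
    - by rewrite -scalemxAr -colE col_frame_mx.
    - move=> j c ec; have [|-> -> //] := F3 i j b c.
      by apply: trmx_inj; rewrite !linearZ /= -e.
  have [|w [w1 w2]] := norm_hahn_banach (A := frame_mx tF) (f := h *m (tG p)^T)
      (linf_norm R d).
    by move=> x; rewrite mulmxA embF -hh; have [bt _] := G1 p; exact: bt.
  exists w^T; split=> //; first exact: dualball_l1.
  by move=> i b e; case: ne; exists i, b.
pose A : 'M[R]_(d, m) := \matrix_(i, p) w p i 0.
have colA p : col p A = w p by apply/matrixP => i j; rewrite !mxE (ord1 j).
exists A.
  apply: linf_isEmb => [p|i]; first by rewrite colA; have [] := hw p.
  have [g /G2[p [b tg]] hg] := extreme_extension hF hG hh (F1 i).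
  exists p, b; rewrite colA; have [_ _] := hw p; apply.
  by rewrite tg linearZ /= -scalemxAr hg.
apply/trmx_inj/row_matrixP => p; rewrite -!tr_col !col_mulmx colA col_frame_mx.
by have [_ -> _] := hw p.
Qed.

Lemma opdist_le k l (NX : 'rV[R]_k -> R) (NY : 'rV[R]_l -> R) (A B : 'M[R]_(k, l)) e :
  is_norm NX -> is_norm NY -> 0 <= e -> opbnd NX NY (A - B) e -> opdist NX NY A B <= e.
Proof. by move=> hX hY; exact: opnorm_le. Qed.

Lemma opdist_bnd k l (NX : 'rV[R]_k -> R) (NY : 'rV[R]_l -> R) (A B : 'M[R]_(k, l)) e :
  is_norm NX -> is_norm NY -> opdist NX NY A B <= e -> opbnd NX NY (A - B) e.
Proof. by move=> hX hY h; apply: opbnd_le h _ => //; exact: opnorm_bnd. Qed.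

Lemma isEmb_mul k l n (NX : 'rV[R]_k -> R) (NY : 'rV[R]_l -> R) (NZ : 'rV[R]_n -> R) A B :
  isEmb NX NY A -> isEmb NY NZ B -> isEmb NX NZ (A *m B).
Proof. by move=> hA hB x; rewrite mulmxA hB hA. Qed.

Lemma linf_isEmb_leq m n (T : 'M[R]_(m, n)) :
  isEmb (@linf R m) (@linf R n) T -> (m <= n)%N.
Proof.
move=> hT; have fT : row_free T.
  apply/inj_row_free => v vT; apply: (is_norm_eq0 (linf_norm R m)).
  by rewrite -hT vT is_norm0 //; exact: linf_norm.
by move: fT => /eqP <-; exact: rank_leq_col.
Qed.

Lemma npol_ex d m r (e : R) : (0 < d)%N -> (0 < m)%N -> 0 < e ->
  exists2 n, (m <= n)%N & npol_prop d m r e n.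
Proof.
move=> d0 m0 e0; case: r => [|r].
  by exists m => // k NF l NG _ _ c; case: (c 0).
have [n hn] := linf_ramsey m r.+1 d0 e0.
exists n; first by have [T [/linf_isEmb_leq]] := hn (fun=> ord0).
move=> k NF l NG polF polG c.
have hF : is_norm NF by case: polF.
have hG : is_norm NG by case: polG.
have [tF [F1 F2 F3]] := in_Pol_frame d0 polF.
have [tG [G1 G2 G3]] := in_Pol_frame m0 polG.
have embF := frame_isEmb hF F1 F2; have embG := frame_isEmb hG G1 G2.
have [T [hT [i hi]]] := hn (fun B => c (frame_mx tF *m B)).
exists (frame_mx tG *m T); split; first exact: isEmb_mul embG hT.
exists i => _ [h hh <-].
have [A hA eA] := frame_extension hF hG F1 F2 F3 G1 G2 hh.
have [B [hB cB AB]] := hi A hA.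
exists (frame_mx tF *m B); split; first exact: isEmb_mul embF hB.
split=> //; apply: opdist_le => //; [exact: linf_norm|exact: ltW|].
by rewrite mulmxA -eA -mulmxA -mulmxBr => x; rewrite mulmxA -embF; exact: AB.
Qed.

(** Allows the property defining n_pol to be applied to linf^d and linf^m. The extreme points of the
    cube are sign vectors, those of the l1 ball the signed unit vectors. *)
Lemma linf_in_Pol d : (0 < d)%N -> in_Pol d (@linf R d).
Proof.
move=> d0; have hl := linf_norm R d; split=> //.
  exists [seq \row_i (-1) ^+ (f i : bool) | f : {ffun 'I_d -> bool}] => x [hx ex].
  have x1 i : `|x 0 i| = 1.
    apply/eqP; rewrite eq_le (le_trans (ler_linf x i) hx) /= leNgt; apply/negP => xi.
    pose u : R := 1 - `|x 0 i|; have u0 : 0 < u by rewrite subr_gt0.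
    have b (s : R) : `|s| <= u -> ball1 (@linf R d) (x + s *: delta_mx 0 i).
      move=> su; apply: linf_le => // j; rewrite !mxE eqxx /=.
      case: eqP => [->|_]; last by rewrite mulr0 addr0 (le_trans (ler_linf x j)).
      rewrite mulr1; apply: le_trans (ler_normD _ _) _.
      by move: su; rewrite /u; lra.
    have /rowP/(_ i) : x + u *: delta_mx 0 i = x + (- u) *: delta_mx 0 i.
      have bu : `|u| <= u by rewrite gtr0_norm.
      have bNu : `|- u| <= u by rewrite normrN.
      apply: (ex _ _ 2^-1 (b _ bu) (b _ bNu)); [lra|lra|].
      by apply/rowP => j; rewrite !mxE; field.
    by rewrite !mxE !eqxx /= !mulr1 => /addrI; lra.
  apply/mapP; exists [ffun i => x 0 i < 0]; first by rewrite mem_enum.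
  by apply/rowP => i; rewrite mxE ffunE -[LHS]mulr_sign_norm x1 mulr1.
exists ([seq delta_mx 0 i | i : 'I_d] ++ [seq - delta_mx 0 i | i : 'I_d]).
have dd (i j : 'I_d) : delta_mx 0 i = delta_mx 0 j :> 'rV[R]_d -> i = j.
  move=> /rowP/(_ i); rewrite !mxE !eqxx /=; case: (i =P j) => //= _ /eqP.
  by rewrite oner_eq0.
have dN (i j : 'I_d) : delta_mx 0 i <> - delta_mx 0 j :> 'rV[R]_d.
  move=> /rowP/(_ i); rewrite !mxE !eqxx /=; case: (i =P j) => _ /= /eqP.
    by rewrite -addr_eq0 -(natrD _ 1 1) pnatr_eq0.
  by rewrite oppr0 oner_eq0.
split.
- rewrite cat_uniq !map_inj_uniq //.
  + rewrite -enumT enum_uniq andbT /=.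
    by apply/hasPn => _ /mapP[i _ ->]; apply/negP => /mapP[j _ /esym/dN].
  + by move=> i j /oppr_inj/dd.
- by rewrite size_cat !size_map -enumT size_enum_ord mul2n addnn.
rewrite dualballE // => f; split.
  move=> [/dualball_l1 bf ef].
  have fN : f != 0.
    apply/eqP => f0; pose e : 'rV[R]_d := delta_mx 0 (Ordinal d0).
    have be : dualball (@linf R d) e.
      by apply: l1_dualball; rewrite trmx_delta l1_delta.
    apply: (@dN (Ordinal d0) (Ordinal d0)).
    apply: (ef e (- e) 2^-1 be (dualballN hl be)); [lra|lra|].
    by rewrite f0 scalerN -scalerBl (_ : 2^-1 - (1 - 2^-1) = 0) ?scale0r //; lra.
  have [i fi] : exists i, f 0 i != 0 by exact/rV0Pn.
  have f0 : 0 < `|f 0 i| by rewrite normr_gt0.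
  pose rest := f - f 0 i *: delta_mx 0 i.
  have ri : rest 0 i = 0 by rewrite !mxE !eqxx mulr1 subrr.
  have l1r : l1 rest^T = l1 f^T - `|f 0 i|.
    rewrite /l1 (bigD1 i) //= [X in _ = X - _](bigD1 i) //= ![_^T i 0]mxE ri.
    rewrite normr0 add0r addrAC subrr add0r; apply: eq_bigr => j /negbTE ji.
    by rewrite !mxE ji andbF mulr0 subr0.
  have sgi : f 0 i = (-1) ^+ (f 0 i < 0)%R * `|f 0 i| by rewrite mulr_sign_norm.
  (* A convex combination of a signed unit vector, with weight [|f 0 i|], and of [rest] rescaled
     into the ball; extremality forces the weight to be one. *)
  have fr : f = `|f 0 i| *: ((-1) ^+ (f 0 i < 0)%R *: delta_mx 0 i) + rest.
    by rewrite scalerA mulrC -sgi addrC subrK.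
  have y_in : dualball (@linf R d) ((-1) ^+ (f 0 i < 0)%R *: delta_mx 0 i).
    by apply: l1_dualball; rewrite linearZ /= trmx_delta l1Z l1_delta mulr1 normrX
      normrN1 expr1n.
  have fi1 : `|f 0 i| = 1.
    have : `|f 0 i| <= 1 by have := l1_ge0 rest^T; move: bf; rewrite l1r; lra.
    rewrite le_eqVlt => /orP[/eqP //|lt1].
    have c0 : 0 < 1 - `|f 0 i| by rewrite subr_gt0.
    have z_in : dualball (@linf R d) ((1 - `|f 0 i|)^-1 *: rest).
      apply: l1_dualball; rewrite linearZ /= l1Z gtr0_norm ?invr_gt0 //.
      by rewrite ler_pdivrMl // mulr1 l1r; lra.
    have eyz : (-1) ^+ (f 0 i < 0)%R *: delta_mx 0 i = (1 - `|f 0 i|)^-1 *: rest.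
      apply: (ef _ _ _ y_in z_in f0 lt1).
      by rewrite [(1 - _) *: _]scalerA divff ?gt_eqF // scale1r.
    move/rowP: eyz => /(_ i)/eqP; rewrite [in X in _ == X]mxE ri mulr0.
    by rewrite !mxE !eqxx mulr1 signr_eq0.
  have r0 : rest = 0.
    apply: trmx_inj; rewrite trmx0; apply/colP => j; rewrite [RHS]mxE; apply/eqP.
    rewrite -normr_le0; have : `|rest^T j 0| <= l1 rest^T.
      by rewrite /l1 (bigD1 j) //= lerDl sumr_ge0.
    by rewrite l1r fi1; move: bf; lra.
  rewrite fr r0 addr0 fi1 scale1r mem_cat; case: (f 0 i < 0).
    by rewrite expr1 scaleN1r; apply/orP; right; apply/mapP; exists i; rewrite ?mem_enum.
  by rewrite expr0 scale1r; apply/orP; left; apply/mapP; exists i; rewrite ?mem_enum.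
have ext i : extreme_point (dualball (@linf R d)) (delta_mx 0 i).
  split=> [|y z t /dualball_l1 by_ /dualball_l1 bz t0 t1 e].
    by apply: l1_dualball; rewrite trmx_delta l1_delta.
  have le1 (w : 'rV[R]_d) : l1 w^T <= 1 -> w 0 i <= 1.
    move=> hw; apply: le_trans (ler_norm _) _; apply: le_trans hw.
    by rewrite /l1 (bigD1 i) //= mxE lerDl sumr_ge0.
  have eq1 (w : 'rV[R]_d) : l1 w^T <= 1 -> w 0 i = 1 -> w = delta_mx 0 i.
    move=> hw wi; apply/rowP => j; rewrite mxE /=.
    have [->|ji] := eqVneq j i; first by rewrite wi.
    apply/eqP; rewrite -normr_le0; move: hw; rewrite /l1 (bigD1 i) //= mxE wi normr1.
    rewrite (bigD1 j) //= mxE.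
    have : 0 <= \sum_(i0 < d | (i0 != i) && (i0 != j)) `|w^T i0 0| by rewrite sumr_ge0.
    lra.
  have [|yi zi] := convex_max t0 t1 (le1 y by_) (le1 z bz).
    by move/rowP: e => /(_ i); rewrite !mxE !eqxx.
  by rewrite (eq1 y) // (eq1 z).
rewrite mem_cat => /orP[/mapP[i _ ->]|/mapP[i _ ->]]; first exact: ext.
exact/extremeN/ext.
Qed.

End Polyhedral.

(** * Amalgamation *)

Section Amalgam.
Variable R : realType.

Section One.
Variables (n k : nat) (NX : 'rV[R]_n -> R) (NF : 'rV[R]_k -> R).
Variables (phi : 'M[R]_(k, n)) (d : R).
Hypotheses (hX : is_norm NX) (hF : is_norm NF) (d0 : 0 < d).
Hypotheses (phi1 : opbnd NF NX phi 1)
  (phid : forall x, (1 - d) * NF x <= NX (x *m phi)).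

(** The price of writing a pair [(y, x)] as [(y + w phi, 0) + (0, x - w) + (- w phi, w)]; the last
    summand, the difference of a point and its image, is charged [d] times the norm of [w]. *)
Definition amalgam_cost (v : 'rV[R]_(n + k)) (w : 'rV[R]_k) : R :=
  NX (lsubmx v + w *m phi) + NF (rsubmx v - w) + d * NF w.

(* The largest norm on the sum of both spaces for which the two inclusions are
   contractions and [phi] is within [d] of the inclusion of its domain. *)
Definition amalgam_norm (v : 'rV[R]_(n + k)) : R :=
  inf [set amalgam_cost v w | w in [set: 'rV[R]_k]].

Lemma amalgam_cost_ge0 v w : 0 <= amalgam_cost v w.
Proof. by rewrite !addr_ge0 ?mulr_ge0 ?is_norm_ge0 // ltW. Qed.

Lemma amalgam_norm_le v w : amalgam_norm v <= amalgam_cost v w.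
Proof.
apply: ge_inf; last by exists w.
by exists 0 => _ [u _ <-]; exact: amalgam_cost_ge0.
Qed.

Lemma le_amalgam_norm v c : (forall w, c <= amalgam_cost v w) -> c <= amalgam_norm v.
Proof.
move=> h; apply: lb_le_inf; first by exists (amalgam_cost v 0), 0.
by move=> _ [w _ <-].
Qed.

Lemma amalgam_normZ_le a v : a != 0 -> amalgam_norm (a *: v) <= `|a| * amalgam_norm v.
Proof.
move=> a0; rewrite -ler_pdivrMl ?normr_gt0 //; apply: le_amalgam_norm => w.
rewrite ler_pdivrMl ?normr_gt0 //; apply: le_trans (amalgam_norm_le _ (a *: w)) _.
have -> : amalgam_cost (a *: v) (a *: w) = `|a| * amalgam_cost v w; last by [].
rewrite /amalgam_cost.
have -> : lsubmx (a *: v) + (a *: w) *m phi = a *: (lsubmx v + w *m phi).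
  by rewrite linearZ /= -scalemxAl scalerDr.
have -> : rsubmx (a *: v) - a *: w = a *: (rsubmx v - w).
  by rewrite linearZ /= scalerBr.
rewrite !is_normZ //; ring.
Qed.

Lemma amalgam_norm_is_norm : is_norm amalgam_norm.
Proof.
split=> [v v0|a v|v v'].
(* Whatever [w] is, the last two terms of the cost dominate [c] times the norm of the second
   component. *)
- pose c := Num.min 1 d; have c0 : 0 < c by rewrite lt_min ltr01.
  have x0 : rsubmx v = 0.
    apply: (is_norm_eq0 hF); apply/eqP; rewrite eq_le is_norm_ge0 // andbT.
    rewrite -(ler_pM2l c0) mulr0 -v0; apply: le_amalgam_norm => w.
    have h1 : NF (rsubmx v) <= NF (rsubmx v - w) + NF w.
      by have := is_normD hF (rsubmx v - w) w; rewrite subrK.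
    have h2 : c * NF (rsubmx v - w) <= NF (rsubmx v - w).
      by rewrite ler_piMl ?is_norm_ge0 // ge_min lexx.
    have h3 : c * NF w <= d * NF w.
      by rewrite ler_wpM2r ?is_norm_ge0 // ge_min lexx orbT.
    have := is_norm_ge0 hX (lsubmx v + w *m phi).
    rewrite -(ler_pM2l c0) mulrDr in h1; rewrite /amalgam_cost; lra.
  have y0 : lsubmx v = 0.
    apply: (is_norm_eq0 hX); apply/eqP; rewrite eq_le is_norm_ge0 // andbT.
    rewrite -v0; apply: le_amalgam_norm => w.
    rewrite /amalgam_cost x0 sub0r is_normN //.
    have h1 : NX (lsubmx v) <= NX (lsubmx v + w *m phi) + NX (w *m phi).
      by have := is_normB hX (lsubmx v + w *m phi) (w *m phi); rewrite addrK.
    have := phi1 w; have := is_norm_ge0 hF w.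
    have : 0 <= d * NF w by rewrite mulr_ge0 ?is_norm_ge0 // ltW.
    lra.
  by rewrite -[v]hsubmxK x0 y0 row_mx0.
- have [->|a0] := eqVneq a 0.
    rewrite scale0r normr0 mul0r; apply/eqP; rewrite eq_le; apply/andP; split.
      apply: le_trans (amalgam_norm_le 0 0) _.
      by rewrite /amalgam_cost [lsubmx 0]linear0 [rsubmx 0]linear0 mul0mx subr0 addr0
        !is_norm0 // mulr0 !addr0.
    by apply: le_amalgam_norm => w; exact: amalgam_cost_ge0.
  apply/eqP; rewrite eq_le amalgam_normZ_le //=.
  rewrite -ler_pdivlMl ?normr_gt0 // -normfV.
  have := @amalgam_normZ_le a^-1 (a *: v); rewrite invr_eq0 => /(_ a0).
  by rewrite scalerA mulVf // scale1r.
- rewrite -lerBlDr; apply: le_amalgam_norm => w; rewrite lerBlDl -lerBlDr.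
  apply: le_amalgam_norm => w'; rewrite lerBlDl.
  apply: le_trans (amalgam_norm_le _ (w + w')) _; rewrite /amalgam_cost.
  have h1 := is_normD hX (lsubmx v + w *m phi) (lsubmx v' + w' *m phi).
  have h2 := is_normD hF (rsubmx v - w) (rsubmx v' - w').
  have h3 := is_normD hF w w'; rewrite -(ler_pM2l d0) in h3.
  rewrite addrACA -mulmxDl -linearD in h1.
  rewrite addrACA -opprD -linearD in h2.
  lra.
Qed.

Lemma amalgam_left : isEmb NX amalgam_norm (row_mx 1%:M 0).
Proof.
move=> y; rewrite mul_mx_row mulmx1 mulmx0; apply/eqP; rewrite eq_le; apply/andP; split.
  apply: le_trans (amalgam_norm_le _ 0) _.
  by rewrite /amalgam_cost row_mxKl row_mxKr mul0mx subr0 !is_norm0 // mulr0 !addr0.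
apply: le_amalgam_norm => w; rewrite /amalgam_cost row_mxKl row_mxKr sub0r is_normN //.
have h1 : NX y <= NX (y + w *m phi) + NX (w *m phi).
  by have := is_normB hX (y + w *m phi) (w *m phi); rewrite addrK.
have := phi1 w; have : 0 <= d * NF w by rewrite mulr_ge0 ?is_norm_ge0 // ltW.
lra.
Qed.

(** Here the lower bound [phid] enters: replacing [w] by its image saves at most [d * NF w], exactly
    what the cost charges. For the other inclusion it is the contraction bound [phi1] that
    matters. *)
Lemma amalgam_right : isEmb NF amalgam_norm (row_mx 0 1%:M).
Proof.
move=> x; rewrite mul_mx_row mulmx1 mulmx0; apply/eqP; rewrite eq_le; apply/andP; split.
  apply: le_trans (amalgam_norm_le _ 0) _.
  by rewrite /amalgam_cost row_mxKl row_mxKr mul0mx subr0 addr0 !is_norm0 // mulr0 add0r addr0.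
apply: le_amalgam_norm => w; rewrite /amalgam_cost row_mxKl row_mxKr add0r.
have h1 : NF x <= NF (x - w) + NF w by have := is_normD hF (x - w) w; rewrite subrK.
have := phid w; lra.
Qed.

Lemma amalgam_close :
  opbnd NF amalgam_norm (row_mx 0 1%:M - phi *m row_mx 1%:M 0) d.
Proof.
move=> x; apply: le_trans (amalgam_norm_le _ x) _.
rewrite mulmxBr mul_mx_row mulmx1 mulmx0 mulmxA mul_mx_row mulmx1 mulmx0.
rewrite /amalgam_cost opp_row_mx add_row_mx row_mxKl row_mxKr oppr0 addr0 add0r.
by rewrite addNr subrr !is_norm0 // !add0r.
Qed.

End One.

(** Each [phi] gets its own copy of the small space, glued along [phi] followed by the inclusions
    made before; these are isometric, so earlier copies survive unchanged. *)
Lemma amalgam n k (NX : 'rV[R]_n -> R) (NF : 'rV[R]_k -> R) d (s : seq 'M[R]_(k, n)) :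
  is_norm NX -> is_norm NF -> 0 < d ->
  (forall phi, phi \in s ->
     opbnd NF NX phi 1 /\ forall x, (1 - d) * NF x <= NX (x *m phi)) ->
  exists kH (NH : 'rV[R]_kH -> R) (J : 'M[R]_(n, kH)),
    [/\ kH = (n + k * size s)%N, is_norm NH, isEmb NX NH J &
     forall phi, phi \in s -> exists2 psi, isEmb NF NH psi &
       opbnd NF NH (psi - phi *m J) d].
Proof.
move=> hX hF d0; elim: s => [_|phi s IH hs].
  by exists n, NX, 1%:M; rewrite muln0 addn0; split=> // x; rewrite mulmx1.
have [|kH [NH [J [kHE hH hJ hpsi]]]] := IH.
  by move=> f fs; apply: hs; rewrite inE fs orbT.
have [p1 pd] := hs phi (mem_head _ _).
have p1' : opbnd NF NH (phi *m J) 1 by move=> x; rewrite mulmxA hJ.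
have pd' x : (1 - d) * NF x <= NH (x *m (phi *m J)) by rewrite mulmxA hJ.
have hL := amalgam_left hH hF d0 p1'.
exists (kH + k)%N, (amalgam_norm NH NF (phi *m J) d), (J *m row_mx 1%:M 0); split.
- by rewrite kHE mulnS -addnA [(k + _)%N]addnC.
- exact: amalgam_norm_is_norm.
- exact: isEmb_mul hJ hL.
- move=> f; rewrite inE => /orP[/eqP ->|fs].
    exists (row_mx 0 1%:M); first exact: amalgam_right.
    by rewrite mulmxA; exact: amalgam_close.
  have [psi epsi cpsi] := hpsi f fs.
  exists (psi *m row_mx 1%:M 0); first exact: isEmb_mul epsi hL.
  by rewrite mulmxA -mulmxBl => x; rewrite mulmxA hL; exact: cpsi.
Qed.

(** [B] is colored by the color of an exact embedding [psi B] near [iF B J]. The four errors belong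
    to the chain from [h gam] through [h iG T J], [iF h' T J] and [iF B J] to [psi B]. *)
Lemma ramsey_transfer kF kG d m n kH r (NF : 'rV[R]_kF -> R) (NG : 'rV[R]_kG -> R)
    (NH : 'rV[R]_kH -> R) (iF : 'M[R]_(kF, d)) (iG : 'M[R]_(kG, m))
    (J : 'M[R]_(n, kH)) (eps e1 eta theta : R) :
  is_norm NF -> is_norm NG -> is_norm NH ->
  ramsey_prop r (@linf R d) (@linf R m) (@linf R n) e1 ->
  isEmb (@linf R n) NH J -> opbnd NF (@linf R d) iF 1 ->
  (forall B, isEmb (@linf R d) (@linf R n) B -> exists2 psi, isEmb NF NH psi &
     opbnd NF NH (psi - iF *m B *m J) eta) ->
  (forall T, isEmb (@linf R m) (@linf R n) T -> exists2 gam, isEmb NG NH gam &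
     opbnd NG NH (gam - iG *m T *m J) eta) ->
  (forall h, isEmb NF NG h -> exists2 h', isEmb (@linf R d) (@linf R m) h' &
     opbnd NF (@linf R m) (h *m iG - iF *m h') theta) ->
  0 <= e1 -> 0 <= eps -> eta + theta + e1 + eta <= eps -> ramsey_prop r NF NG NH eps.
Proof.
move=> hF hG hH ram hJ iF1 hB hT hh e10 eps0 sum c.
have hl k := linf_norm R k.
have /choice[psi hpsi] : forall B, exists psi : 'M[R]_(kF, kH),
    isEmb (@linf R d) (@linf R n) B ->
    isEmb NF NH psi /\ opbnd NF NH (psi - iF *m B *m J) eta.
  move=> B; have [/hB[psi p1 p2]|nB] := pselect (isEmb (@linf R d) (@linf R n) B).
    by exists psi.
  by exists 0.
have [T [eT [i hi]]] := ram (c \o psi).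
have [gam egam cgam] := hT T eT.
exists gam; split=> //; exists i => _ [h eh <-].
have [h' eh' ch'] := hh h eh.
have [B [eB [/= cB /(opdist_bnd (hl d) (hl n)) AB]]] := hi (h' *m T) (ex_intro2 _ _ h' eh' erefl).
have [epsi cpsi] := hpsi B eB.
exists (psi B); split=> //; split=> //; apply: opdist_le => //.
apply: opbnd_le sum _ => //.
have s1 : opbnd NF NH (h *m gam - h *m iG *m T *m J) eta.
  have -> : h *m gam - h *m iG *m T *m J = h *m (gam - iG *m T *m J).
    by rewrite mulmxBr !mulmxA.
  by move=> x; rewrite mulmxA -(eh x); exact: cgam.
have s2 : opbnd NF NH (h *m iG *m T *m J - iF *m h' *m T *m J) theta.
  by rewrite -!mulmxBl => x; rewrite 2!mulmxA hJ eT; exact: ch'.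
have s3 : opbnd NF NH (iF *m h' *m T *m J - iF *m B *m J) e1.
  rewrite -mulmxBl -[iF *m h' *m T]mulmxA -mulmxBr => x.
  rewrite mulmxA hJ mulmxA; apply: le_trans (AB _) _.
  by rewrite ler_wpM2l // -[leRHS]mul1r.
have s4 := opbndBC hH cpsi.
exact: (opbnd_tri hH (opbnd_tri hH (opbnd_tri hH s1 s2) s3) s4).
Qed.

End Amalgam.

(** * Approximation by functionals *)

Section Approximation.
Variable R : realType.

Notation linf1 := (@linf R 1).

Lemma linf1E (y : 'rV[R]_1) : linf y = `|y 0 0|.
Proof.
apply/eqP; rewrite eq_le ler_linf andbT; apply: linf_le => // i.
by rewrite (ord1 i).
Qed.

(** The default of [nth] pads a short list with zero columns, so a net may have fewer than [d]
    members. *)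
Definition seq_mx k d (s : seq 'cV[R]_k) : 'M[R]_(k, d) := \matrix_(x, j) nth 0 s j x 0.

Lemma col_seq_mx k d (s : seq 'cV[R]_k) j : col j (seq_mx d s) = nth 0 s j.
Proof. by apply/matrixP => x y; rewrite !mxE (ord1 y). Qed.

Lemma mulmx_colE k d (x : 'rV[R]_k) (A : 'M[R]_(k, d)) j :
  (x *m A) 0 j = (x *m col j A) 0 0.
Proof. by rewrite -col_mulmx [RHS]mxE. Qed.

Section OneNorm.
Variables (k : nat) (N : 'rV[R]_k -> R).
Hypothesis hN : is_norm N.

Lemma opbnd_cols d (A : 'M[R]_(k, d)) c : 0 <= c ->
  (forall j, opbnd N linf1 (col j A) c) -> opbnd N (@linf R d) A c.
Proof.
move=> c0 h x; apply: linf_le => [|j]; first by rewrite mulr_ge0 ?is_norm_ge0.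
by rewrite mulmx_colE -linf1E; exact: h.
Qed.

Lemma opbnd0 l (NY : 'rV[R]_l -> R) c : is_norm NY -> 0 <= c ->
  opbnd N NY (0 : 'M[R]_(k, l)) c.
Proof. by move=> hY c0 x; rewrite mulmx0 is_norm0 // mulr_ge0 ?is_norm_ge0. Qed.

Lemma opbnd_seq_mx d (s : seq 'cV[R]_k) :
  (forall f, f \in s -> opbnd N linf1 f 1) -> opbnd N (@linf R d) (seq_mx d s) 1.
Proof.
move=> h; apply: opbnd_cols => // j; rewrite col_seq_mx.
have [js|js] := ltnP j (size s); first exact/h/mem_nth.
by rewrite nth_default //; apply: opbnd0 => //; exact: linf_norm.
Qed.

Lemma seq_mx_ge d (s : seq 'cV[R]_k) f (x : 'rV[R]_k) : f \in s -> (size s <= d)%N ->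
  linf (x *m f) <= linf (x *m seq_mx d s).
Proof.
move=> fs sd; have fd : (index f s < d)%N by apply: leq_trans sd; rewrite index_mem.
rewrite linf1E; have := ler_linf (x *m seq_mx d s) (Ordinal fd).
by rewrite mulmx_colE col_seq_mx /= nth_index.
Qed.

Lemma unit_functional (x : 'rV[R]_k) : x != 0 ->
  exists2 f : 'cV[R]_k, opnorm N linf1 f = 1 & linf (x *m f) = N x.
Proof.
move=> x0; have Nx := is_norm_gt0 hN x0.
have [f hf fx] := norming_functional x hN; exists f^T; last first.
  by rewrite linf1E fx ger0_norm // ltW.
have hl := linf_norm R 1; apply/eqP; rewrite eq_le; apply/andP; split.
  apply: opnorm_le => // y; rewrite mul1r linf1E ler_norml hf andbT lerNl.
  by have := hf (- y); rewrite mulNmx [X in X <= _]mxE is_normN.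
rewrite -(ler_pM2r Nx) mul1r; apply: le_trans (opnorm_bnd hN hl f^T x).
by rewrite linf1E fx ler_norm.
Qed.

(* A net of the dual unit sphere; rescaling it approximates the dual ball. *)
Lemma sphere_net d : 0 < d -> exists s : seq 'cV[R]_k,
  [/\ forall f, f \in s -> opnorm N linf1 f = 1, (size s)%:R <= (1 + 2 / d) ^+ k,
   (forall x, x != 0 -> exists2 f, f \in s & (1 - d) * N x <= linf (x *m f)) &
   forall D f, (size s <= D)%N -> opbnd N linf1 f 1 ->
     exists w : 'cV[R]_D, l1 w <= 1 /\ opbnd N linf1 (f - seq_mx D s *m w) d].
Proof.
move=> d0; have hl := linf_norm R 1.
have [|s [hs sz net]] := opnet_ex (S := [set f : 'cV[R]_k | opnorm N linf1 f = 1])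
    hN hl d0.
  by move=> f /= f1; have := opnorm_bnd hN hl f; rewrite f1.
rewrite muln1 in sz; exists s; split=> // [x x0|D f sD hf].
  have [f f1 fx] := unit_functional x0; have [g gs fg] := net f f1.
  exists g => //; have := fg x; rewrite mulmxBr => h.
  have := is_normD hl (x *m f - x *m g) (x *m g); rewrite subrK fx.
  by rewrite mulrBl mul1r; lra.
have [f0|f0] := eqVneq (opnorm N linf1 f) 0.
  exists 0; rewrite l1_0; split=> //; rewrite mulmx0 subr0.
  by apply: opbnd_le (opnorm_bnd hN hl f) => //; rewrite f0 ltW.
have fn0 : 0 < opnorm N linf1 f by rewrite lt_neqAle eq_sym f0 opnorm_ge0.
set c := opnorm N linf1 f in f0 fn0 *.
have c1 : c <= 1 by exact: opnorm_le.
have [|g gs fg] := net (c^-1 *: f).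
  have := opnorm_is_norm hN hl => -[_ /(_ c^-1 (mxvec f)) + _].
  by rewrite linearZ /= mxvecK => /= ->; rewrite -/c gtr0_norm ?invr_gt0 // mulVf.
have gD : (index g s < D)%N by apply: leq_trans sD; rewrite index_mem.
exists (c *: delta_mx (Ordinal gD) 0); split.
  by rewrite l1Z l1_delta mulr1 gtr0_norm.
rewrite -scalemxAr -colE col_seq_mx /= nth_index //.
have -> : f - c *: g = c *: (c^-1 *: f - g).
  by rewrite scalerBr scalerA divff // scale1r.
apply: opbnd_le (opbndZ hl c fg) => //; rewrite gtr0_norm //.
by rewrite -[leRHS]mul1r ler_pM2r.
Qed.

End OneNorm.

(** On a line all functionals are proportional, so one of norm one attains the norm at every vector.
    This is why the net is taken on the dual sphere and amalgamation can be avoided when both spaces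
    are lines. *)
Lemma seq_mx_isEmb1 (N : 'rV[R]_1 -> R) d (s : seq 'cV[R]_1) f : is_norm N ->
  (forall g, g \in s -> opbnd N linf1 g 1) -> f \in s -> opnorm N linf1 f = 1 ->
  (size s <= d)%N -> isEmb N (@linf R d) (seq_mx d s).
Proof.
move=> hN hs fs f1 sd x; apply/eqP; rewrite eq_le; apply/andP; split.
  by rewrite -[leRHS]mul1r; exact: opbnd_seq_mx.
apply: le_trans (seq_mx_ge x fs sd).
have NE (y : 'rV[R]_1) : N y = `|y 0 0| * N 1%:M.
  have e : y = y 0 0 *: 1%:M by rewrite scalemx1 -mx11_scalar.
  by rewrite {1}e is_normZ.
have lE (y : 'rV[R]_1) : linf (y *m f) = `|y 0 0| * `|f 0 0|.
  by rewrite linf1E mxE big_ord1 normrM.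
have N1 : 0 < N 1%:M by apply: is_norm_gt0 => //; exact: oner_neq0.
rewrite NE lE ler_wpM2l //.
suff : opnorm N linf1 f <= `|f 0 0| / N 1%:M by rewrite f1 ler_pdivlMr // mul1r.
apply: opnorm_le => // [|y]; first by rewrite divr_ge0 // ltW.
by rewrite lE (NE y) mulrCA divfK ?gt_eqF.
Qed.

(* [L] consists of [sG] and of extensions along the members of the net [nh] of
   the functionals in [sF]; the latter make the extension [h'] isometric. *)
Lemma frame_net_extension kF kG (NF : 'rV[R]_kF -> R) (NG : 'rV[R]_kG -> R) e e' d m
    (sF : seq 'cV[R]_kF) (sG : seq 'cV[R]_kG) (nh : seq 'M[R]_(kF, kG)) :
  is_norm NF -> is_norm NG -> 0 <= e -> (size sF <= d)%N ->
  (size sG + size nh * d <= m)%N ->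
  (forall f, f \in sF -> opbnd NF linf1 f 1) ->
  (forall f, opbnd NF linf1 f 1 ->
     exists w : 'cV[R]_d, l1 w <= 1 /\ opbnd NF linf1 (f - seq_mx d sF *m w) e) ->
  (forall g, g \in sG -> opbnd NG linf1 g 1) ->
  (forall h, h \in nh -> isEmb NF NG h) ->
  (forall h, isEmb NF NG h -> exists2 h0, h0 \in nh & opbnd NF NG (h - h0) e') ->
  exists L : seq 'cV[R]_kG,
    [/\ {subset sG <= L}, (size L <= m)%N, forall g, g \in L -> opbnd NG linf1 g 1 &
     forall h, isEmb NF NG h -> exists2 h', isEmb (@linf R d) (@linf R m) h' &
       opbnd NF (@linf R m) (h *m seq_mx m L - seq_mx d sF *m h') (e' + e)].
Proof.
move=> hF hG e0 sd sm sF1 sFw sG1 nh1 nhe; have hl k := linf_norm R k.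
have /choice[ext hext] : forall hf : 'M[R]_(kF, kG) * 'cV[R]_kF, exists g : 'cV[R]_kG,
    opbnd NG linf1 g 1 /\
    (isEmb NF NG hf.1 -> opbnd NF linf1 hf.2 1 -> hf.1 *m g = hf.2).
  move=> [h f] /=.
  have [[eh f1]|nf] := pselect (isEmb NF NG h /\ opbnd NF linf1 f 1); last first.
    by exists 0; split=> [|eh f1]; [exact: opbnd0|case: nf].
  have [|g [hg bg]] := norm_hahn_banach (A := h) (f := f) hG.
    move=> x; rewrite eh -[leRHS]mul1r; apply: le_trans (f1 x).
    by rewrite linf1E ler_norm.
  exists g^T; split=> // y; rewrite mul1r linf1E ler_norml bg andbT lerNl.
  by have := bg (- y); rewrite mulNmx [X in X <= _]mxE is_normN.
(* One block of length [d] for each member of [nh]. Blocks are not cut at [size sF], because the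
   zero columns of [seq_mx d sF] also need a unit column in [h']. *)
pose L := sG ++ mkseq (fun q => ext (nth 0 nh (q %/ d), nth 0 sF (q %% d))) (size nh * d).
have L1 g : g \in L -> opbnd NG linf1 g 1.
  rewrite mem_cat => /orP[/sG1//|/mapP[q _ ->]]; exact: (proj1 (hext _)).
have sF0 j : opbnd NF linf1 (nth 0 sF j) 1.
  have [js|js] := ltnP j (size sF); first exact/sF1/mem_nth.
  by rewrite nth_default //; exact: opbnd0.
have L0 p : opbnd NG linf1 (nth 0 L p) 1.
  have [js|js] := ltnP p (size L); first exact/L1/mem_nth.
  by rewrite nth_default //; exact: opbnd0.
exists L; split=> //.
- by move=> g gs; rewrite mem_cat gs.
- by rewrite size_cat size_mkseq.
move=> h eh; have [h0 h0n hh0] := nhe h eh; have eh0 := nh1 h0 h0n.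
pose pos (j : nat) := (size sG + (index h0 nh * d + j))%N.
have posL (j : 'I_d) : (pos j < size L)%N.
  rewrite size_cat size_mkseq ltn_add2l.
  have := h0n; rewrite -index_mem => h1; apply: leq_trans (leq_mul h1 (leqnn d)).
  by rewrite mulSn addnC ltn_add2r.
have nthpos (j : 'I_d) : h0 *m nth 0 L (pos j) = nth 0 sF j.
  have := posL j; rewrite /L size_cat size_mkseq ltn_add2l => jl.
  rewrite nth_cat /pos ltnNge leq_addr /= addKn nth_mkseq //.
  have d0 : (0 < d)%N by exact: leq_ltn_trans (ltn_ord j).
  rewrite divnMDl // divn_small // addn0 modnMDl modn_small // nth_index //.
  exact: (proj2 (hext (h0, _)) eh0 (sF0 _)).
(* On the block of [h0] the columns are unit vectors, without error, which makes [h'] isometric;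
   elsewhere they come from the approximation of the dual ball. *)
have /choice[w hw] : forall p : 'I_m, exists w : 'cV[R]_d,
    [/\ l1 w <= 1, opbnd NF linf1 (h0 *m nth 0 L p - seq_mx d sF *m w) e &
     forall j : 'I_d, p = pos j :> nat -> w = delta_mx j 0].
  move=> p; have [[j pj]|np] := pselect (exists j : 'I_d, p = pos j :> nat).
    exists (delta_mx j 0); split; first by rewrite l1_delta.
    - by rewrite pj nthpos -colE col_seq_mx subrr; exact: opbnd0.
    - by move=> j'; rewrite pj => /addnI/addnI/val_inj ->.
  have [|w [w1 w2]] := sFw (h0 *m nth 0 L p).
    by move=> x; rewrite mulmxA -(eh0 x); exact: L0.
  by exists w; split=> // j pj; case: np; exists j.
pose h' : 'M[R]_(d, m) := \matrix_(i, p) w p i 0.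
have colh p : col p h' = w p by apply/matrixP => i j; rewrite !mxE (ord1 j).
exists h'.
  apply: linf_isEmb => [p|j]; first by rewrite colh; have [] := hw p.
  have pm : (pos j < m)%N by apply: leq_trans (posL j) _; rewrite size_cat size_mkseq.
  exists (Ordinal pm), false; rewrite colh expr0 scale1r.
  by have [_ _] := hw (Ordinal pm); apply.
apply: (opbnd_tri (hl m) (B := h0 *m seq_mx m L)).
  rewrite -mulmxBl => x; rewrite mulmxA; apply: le_trans (hh0 x).
  by rewrite -[leRHS]mul1r; exact: opbnd_seq_mx.
apply: opbnd_cols => // p; rewrite linearB /= !col_mulmx col_seq_mx colh.
by have [] := hw p.
Qed.

Lemma linf_Emb_ex d n : (d <= n)%N -> exists B : 'M[R]_(d, n), isEmb (@linf R d) (@linf R n) B.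
Proof.
move=> dn; exists (\matrix_(i, j) (i == j :> nat)%:R).
apply: linf_isEmb => [p|i].
  have [pd|pd] := ltnP p d.
    rewrite /l1 (bigD1 (Ordinal pd)) //= big1 ?addr0 => [|j jp].
      by rewrite !mxE eqxx normr1.
    rewrite !mxE; case: eqP => [e|]; last by rewrite normr0.
    by case/eqP: jp; exact: val_inj.
  rewrite /l1 big1 // => j _; rewrite !mxE (_ : (j == p :> nat) = false) ?normr0 //.
  by apply/eqP => e; have := ltn_ord j; rewrite e ltnNge pd.
exists (widen_ord dn i), false; rewrite expr0 scale1r.
by apply/matrixP => j q; rewrite !mxE (ord1 q) andbT.
Qed.

(** Lets one factor of the final product absorb several terms of a sum. The threshold is a lower
    bound for [b = 9 + 40 / eps]. *)
Lemma powR_growth k (X : R) : (1 < k)%N -> 9 <= X -> 4 * (k%:R * X) <= k%:R `^ X.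
Proof.
move=> k1 X9; have X0 : 0 <= X by lra.
have /andP[yX Xy] := truncn_itv X0; set y := Num.truncn X in yX Xy.
have y9 : (9 <= y)%N by rewrite truncn_ge_nat.
have h2 z : (4 * (z + 10) <= 2 ^ (z + 8))%N.
  elim: z => // z IH; rewrite addSn [in X in (_ <= X)%N]addSn expnS mul2n -addnn.
  by rewrite mulnS addnC; apply: leq_add => //; apply: leq_trans IH; rewrite leq_pmulr ?addnS.
apply: (@le_trans _ _ (k%:R ^+ y)); last first.
  by rewrite -powR_mulrn ?ler0n // ler_powR // ler1n ltnW.
have := h2 (y - 9)%N; rewrite -(ler_nat R).
have -> : (y - 9 + 10 = y.+1)%N by rewrite addnS -[9%N]/9%N subnK.
have -> : (y - 9 + 8 = y.-1)%N by case: (y) y9 => // y' y9'; rewrite subSS subnK.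
rewrite natrM natrX => h; have -> : y = (y.-1).+1 by rewrite prednK // (leq_trans _ y9).
rewrite exprS mulrCA ler_wpM2l // (le_trans _ (le_trans h _)) //.
  by rewrite ler_pM2l // ltW.
by apply: lerXn2r; rewrite ?nnegrE // ler_nat.
Qed.

(** If one dimension is one, its factor is one, and the other factor, whose exponent is at least as
    large, absorbs both terms. If both are one the product is just [n], hence the exclusion. *)
Lemma dim_bound (kF kG n p q : nat) (b : R) : 9 <= b -> (0 < kF)%N -> (0 < kG)%N ->
  (0 < n)%N -> ~~ ((kF == 1%N) && (kG == 1%N)) ->
  p%:R <= b ^+ (kF * n) -> q%:R <= b ^+ (kG * n) ->
  (n + kF * p + kG * q)%:R <=
    (kF%:R `^ (b ^+ (n * kF))) * (kG%:R `^ (b ^+ (n * kG))) * n%:R.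
Proof.
move=> b9 kF0 kG0 n0 nk hp hq; rewrite ![(n * _)%N]mulnC.
set X := b ^+ (kF * n) in hp *; set Y := b ^+ (kG * n) in hq *.
have b1 : 1 <= b by lra.
have bexp k : (0 < k)%N -> 9 <= b ^+ (k * n).
  move=> k0; rewrite -(prednK (n := k * n)) ?muln_gt0 ?k0 // exprS.
  have : 1 <= b ^+ (k * n).-1 by exact: exprn_ege1.
  nra.
have X9 : 9 <= X by exact: bexp.
have Y9 : 9 <= Y by exact: bexp.
have n1 : 1 <= n%:R :> R by rewrite ler1n.
have F1 : 1 <= kF%:R :> R by rewrite ler1n.
have G1 : 1 <= kG%:R :> R by rewrite ler1n.
rewrite !natrD !natrM.
apply: (@le_trans _ _ (n%:R + kF%:R * X + kG%:R * Y)).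
  by rewrite !lerD // ler_wpM2l.
have mono k k' : (k <= k')%N -> b ^+ (k * n) <= b ^+ (k' * n).
  by move=> kk; rewrite ler_weXn2l // leq_mul2r kk orbT.
have KX k (Z : R) : (0 < k)%N -> 9 <= Z -> 9 <= k%:R * Z.
  move=> k0 Z9; apply: (le_trans Z9); rewrite ler_peMl ?ler1n //; lra.
have FX := KX kF X kF0 X9; have GY := KX kG Y kG0 Y9.
have [kF1|kF1] := eqVneq kF 1%N.
  have kG1 : (1 < kG)%N.
    by rewrite ltn_neqAle eq_sym kG0 andbT; move: nk; rewrite kF1 eqxx.
  have XY : X <= Y by apply: mono; rewrite kF1.
  have h := powR_growth kG1 Y9.
  rewrite {2}kF1 powR1 mul1r; apply: (@le_trans _ _ (4 * (kG%:R * Y) * n%:R)); last first.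
    by rewrite ler_wpM2r.
  rewrite {1}kF1 mul1r; nra.
have {}kF1 : (1 < kF)%N by rewrite ltn_neqAle eq_sym kF1.
have hF := powR_growth kF1 X9.
have [kG1|kG1] := eqVneq kG 1%N.
  have YX : Y <= X by apply: mono; rewrite kG1.
  rewrite {2}kG1 powR1 mulr1; apply: (@le_trans _ _ (4 * (kF%:R * X) * n%:R)); last first.
    by rewrite ler_wpM2r.
  rewrite {1}kG1 mul1r; nra.
have {}kG1 : (1 < kG)%N by rewrite ltn_neqAle eq_sym kG1.
have hG := powR_growth kG1 Y9.
apply: (@le_trans _ _ ((4 * (kF%:R * X)) * (4 * (kG%:R * Y)) * n%:R)); last first.
  by rewrite ler_wpM2r // ler_pM // mulr_ge0 //; lra.
set u := kF%:R * X in FX *; set v := kG%:R * Y in GY *.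
have : u + v <= u * v by nra.
have : 0 <= u * v by nra.
nra.
Qed.

End Approximation.

(** * Construction of [H] and the dimension bound *)

Lemma embedding_net_close (R : realType) k d n (N : 'rV[R]_k -> R) (iF : 'M[R]_(k, d)) e :
  is_norm N -> 0 < e -> opbnd N (@linf R d) iF 1 ->
  exists s : seq 'M[R]_(k, n),
    [/\ forall A, A \in s -> exists2 B, isEmb (@linf R d) (@linf R n) B & A = iF *m B,
     (size s)%:R <= (1 + 2 / e) ^+ (k * n) &
     forall B, isEmb (@linf R d) (@linf R n) B ->
       exists2 A, A \in s & opbnd N (@linf R n) (A - iF *m B) e].
Proof.
move=> hN e0 i1; have hl m := linf_norm R m.
(* The net is taken among the composites and not among the [B]: the exponent becomes [k * n] instead
   of [d * n], and each member inherits the lower estimate of [iF]. *)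
pose S : set 'M[R]_(k, n) := [set iF *m B | B in [set B | isEmb (@linf R d) (@linf R n) B]].
have [|s [hs sz net]] := opnet_ex (S := S) hN (hl n) e0.
  by move=> _ [B hB <-] x; rewrite mulmxA hB; exact: i1.
exists s; split=> // [A /hs[B hB <-]|B hB]; first by exists B.
have [|A As hA] := net (iF *m B); first by exists B.
by exists A => //; exact: opbndBC.
Qed.

(** Copies of F and then of G are glued to linf^n. A composite is within [e'] of the net and gluing
    costs [e], for F and for G alike; the approximation of [h] adds another [e' + e], whence
    [3 * (e + e')]. *)
Lemma ramsey_space (R : realType) (kF kG d m n r : nat) (NF : 'rV[R]_kF -> R)
    (NG : 'rV[R]_kG -> R) (iF : 'M[R]_(kF, d)) (iG : 'M[R]_(kG, m)) (e e' e1 eps : R) :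
  is_norm NF -> is_norm NG -> 0 < e -> 0 < e' -> 0 <= e1 -> (d <= n)%N ->
  opbnd NF (@linf R d) iF 1 -> (forall x, (1 - e) * NF x <= linf (x *m iF)) ->
  opbnd NG (@linf R m) iG 1 -> (forall x, (1 - e) * NG x <= linf (x *m iG)) ->
  (forall h, isEmb NF NG h -> exists2 h', isEmb (@linf R d) (@linf R m) h' &
     opbnd NF (@linf R m) (h *m iG - iF *m h') (e' + e)) ->
  ramsey_prop r (@linf R d) (@linf R m) (@linf R n) e1 ->
  3 * (e + e') + e1 <= eps ->
  exists p q : nat,
  [/\ p%:R <= (1 + 2 / e') ^+ (kF * n), q%:R <= (1 + 2 / e') ^+ (kG * n) &
   exists (NH : 'rV[R]_(n + kF * p + kG * q) -> R),
     [/\ is_norm NH, Emb NF NH !=set0 & ramsey_prop r NF NG NH eps]].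
Proof.
move=> hF hG e0 e'0 e10 dn iF1 iFe iG1 iGe hh ram sum; have hl k := linf_norm R k.
have [sF [sF1 sFs sFn]] := embedding_net_close n hF e'0 iF1.
have [sG [sG1 sGs sGn]] := embedding_net_close n hG e'0 iG1.
have [|k1 [N1 [J1 [k1E hN1 hJ1 hF1]]]] := @amalgam _ n kF (@linf R n) NF e sF (hl n) hF e0.
  move=> _ /sF1[B hB ->]; split=> x; rewrite mulmxA hB; [exact: iF1 | exact: iFe].
have [|k2 [N2 [J2 [k2E hN2 hJ2 hG2]]]] :=
    @amalgam _ k1 kG N1 NG e [seq A *m J1 | A <- sG] hN1 hG e0.
  move=> _ /mapP[_ /sG1[B hB ->] ->].
  by split=> x; rewrite mulmxA hJ1 mulmxA hB; [exact: iG1 | exact: iGe].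
subst k1 k2; rewrite size_map in N2 J2 hN2 hJ2 hG2.
have hJ : isEmb (@linf R n) N2 (J1 *m J2) by exact: isEmb_mul hJ1 hJ2.
have hB B : isEmb (@linf R d) (@linf R n) B -> exists2 psi, isEmb NF N2 psi &
    opbnd NF N2 (psi - iF *m B *m (J1 *m J2)) (e + e').
  move=> /sFn[A As hA]; have [psi epsi cpsi] := hF1 A As.
  exists (psi *m J2); first exact: isEmb_mul epsi hJ2.
  apply: (opbnd_tri hN2 (B := A *m (J1 *m J2))).
    by rewrite mulmxA -mulmxBl => x; rewrite mulmxA hJ2; exact: cpsi.
  by rewrite -mulmxBl => x; rewrite mulmxA hJ; exact: hA.
exists (size sF), (size sG); split=> //; exists N2; split=> //.
  have [B /hB[psi epsi _]] := linf_Emb_ex R dn; by exists psi.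
apply: (ramsey_transfer hF hG hN2 ram hJ iF1 hB (theta := e' + e)) => //; last first.
- by apply: le_trans sum; lra.
- by apply: le_trans sum; rewrite addr_ge0 // mulr_ge0 // addr_ge0 // ltW.
- exact: hh.
move=> T /sGn[A As hA]; have [|gam egam cgam] := hG2 (A *m J1); first exact: map_f.
exists gam => //; apply: (opbnd_tri hN2 (B := A *m (J1 *m J2))).
  by rewrite mulmxA.
by rewrite -mulmxBl => x; rewrite mulmxA hJ; exact: hA.
Qed.

Theorem theorem6p33 (R : realType) (kF : nat) (NF : 'rV[R]_kF -> R)
  (kG : nat) (NG : 'rV[R]_kG -> R) (r : nat) (eps : R) :
  (0 < kF)%N -> (0 < kG)%N -> is_norm NF -> is_norm NG -> 0 < eps ->
  let a : R := (10 + 3 * eps) / eps in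
  let b : R := 1 + 8 * (5 + eps) / eps in
  exists n : nat,
    is_npol (Num.truncn (a ^+ kF))
            (Num.truncn (a ^+ kG + a ^+ kF * b ^+ (kF * kG)))
            r (eps / 4) n /\
    exists (kH : nat) (NH : 'rV[R]_kH -> R),
      [/\ is_norm NH,
          Emb NF NH !=set0,
          ramsey_prop r NF NG NH eps &
          (kH%:R : R) <= (kF%:R `^ (b ^+ (n * kF))) *
                         (kG%:R `^ (b ^+ (n * kG))) * n%:R].
Proof.
move=> kF0 kG0 hF hG eps0 a b.
have hl k := linf_norm R k.
(* The error budget: [3 * (e + e')] is 15/4 of [e], at most 3/4 of [eps] since [e <= eps / 5], and
   the Ramsey property spends the remaining [eps / 4]. *)
pose e := eps / (5 + eps); pose e' := e / 4.
have e0 : 0 < e by rewrite divr_gt0 // addr_gt0.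
have e'0 : 0 < e' by rewrite divr_gt0.
have aE : a = 1 + 2 / e by rewrite /a /e; field; lra.
have bE : b = 1 + 2 / e' by rewrite /b /e' /e; field; lra.
have e5 : e <= eps / 5 by rewrite ler_pdivrMr ?addr_gt0 //; nra.
have a1 : 1 <= a by rewrite aE lerDl divr_ge0 // ltW.
have b9 : 9 <= b.
  rewrite /b; have -> : 8 * (5 + eps) / eps = 8 + 40 / eps by field; lra.
  by have : 0 < 40 / eps by [rewrite divr_gt0]; lra.
have aexp k : 1 <= a ^+ k by exact: exprn_ege1.
have bexp k : 1 <= b ^+ k by apply: exprn_ege1; lra.
set d := Num.truncn (a ^+ kF); set m := Num.truncn _.
have d0 : (0 < d)%N by rewrite truncn_gt0.
have mle : a ^+ kF <= a ^+ kG + a ^+ kF * b ^+ (kF * kG).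
  by have := aexp kF; have := aexp kG; have := bexp (kF * kG)%N; nra.
have dm : (d <= m)%N by exact: le_truncn.
have m0 : (0 < m)%N by exact: leq_trans dm.
have e40 : 0 < eps / 4 by rewrite divr_gt0.
have [n nP] : exists n, is_npol d m r (eps / 4) n.
  have [n0 mn0 hn0] := npol_ex r d0 m0 e40.
  have ex : exists n, (m <= n)%N && `[< npol_prop d m r (eps / 4) n >].
    by exists n0; rewrite mn0; exact/asboolP.
  case: (ex_minnP ex) => n /andP[mn /asboolP hn] nmin; exists n; split=> // n' mn' hn'.
  by apply: nmin; rewrite mn'; exact/asboolP.
exists n; split=> //; case: nP => mn npol _.
have dn := leq_trans dm mn; have n0 := leq_trans m0 mn.
have ram := npol _ _ _ _ (linf_in_Pol R d0) (linf_in_Pol R m0).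
have [sF [sF1 sFs sFx sFw]] := sphere_net hF e0.
have [sG [sG1 sGs sGx sGw]] := sphere_net hG e0.
have [|nh [nh1 nhs nhe]] := opnet_ex (S := Emb NF NG) hF hG e'0.
  by move=> h; exact: isEmb_opbnd.
(* Rounding down in [d] and [m] loses nothing, the sizes of nets being integers. *)
have sFd : (size sF <= d)%N by rewrite truncn_ge_nat ?aE // exprn_ge0 // -aE (le_trans _ a1).
have bnd1 k (N : 'rV[R]_k -> R) (s : seq 'cV[R]_k) : is_norm N ->
    (forall f, f \in s -> opnorm N (@linf R 1) f = 1) ->
    forall f, f \in s -> opbnd N (@linf R 1) f 1.
  by move=> hN hs f /hs f1; have := opnorm_bnd hN (hl 1%N) f; rewrite f1.
have sizes : (size sG + size nh * d <= m)%N.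
  rewrite truncn_ge_nat; last by rewrite (le_trans _ mle) // (le_trans _ (aexp kF)).
  rewrite natrD natrM aE; apply: lerD => //; rewrite mulrC bE.
  apply: ler_pM => //; rewrite -aE truncn_le.
  by rewrite (le_trans _ (aexp kF)).
have [L [sL Lm L1 Lext]] := frame_net_extension hF hG (ltW e0) sFd sizes
  (bnd1 _ _ _ hF sF1) (fun f => sFw d f sFd) (bnd1 _ _ _ hG sG1) nh1 nhe.
pose iF := seq_mx d sF; pose iG := seq_mx m L.
have iF1 : opbnd NF (@linf R d) iF 1 by apply: opbnd_seq_mx => //; exact: bnd1.
have iG1 : opbnd NG (@linf R m) iG 1 by exact: opbnd_seq_mx.
have low k (N : 'rV[R]_k -> R) (s s' : seq 'cV[R]_k) D : is_norm N ->
    (forall x, x != 0 -> exists2 f, f \in s & (1 - e) * N x <= linf (x *m f)) ->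
    {subset s <= s'} -> (size s' <= D)%N ->
    forall x, (1 - e) * N x <= linf (x *m seq_mx D s').
  move=> hN hs ss sD x; have [->|/hs[f fs fx]] := eqVneq x 0.
    by rewrite is_norm0 // mulr0 linf_ge0.
  by apply: (le_trans fx); apply: seq_mx_ge => //; exact: ss.
have iFe := low _ NF sF sF d hF sFx (fun _ => id) sFd.
have iGe := low _ NG sG L m hG sGx sL Lm.
have [/andP[/eqP kF1 /eqP kG1]|nk] := boolP ((kF == 1%N) && (kG == 1%N)).
  subst kF kG; have x1 : (1%:M : 'rV[R]_1) != 0 by exact: oner_neq0.
  have [f fs _] := sFx _ x1; have [g gs _] := sGx _ x1.
  have eF : isEmb NF (@linf R d) iF.
    by apply: (seq_mx_isEmb1 hF (bnd1 _ _ _ hF sF1) fs) => //; exact: sF1.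
  have eG : isEmb NG (@linf R m) iG.
    by apply: (seq_mx_isEmb1 hG L1 (sL _ gs)) => //; exact: sG1.
  exists n, (@linf R n); split=> //.
  - have [B hB] := linf_Emb_ex R dn; exists (iF *m B); exact: isEmb_mul eF hB.
  - have e1 : isEmb (@linf R n) (@linf R n) 1%:M by move=> x; rewrite mulmx1.
    apply: (ramsey_transfer hF hG (hl n) ram e1 iF1 (iG := iG) (eta := 0)
      (theta := e' + e)) => //; try exact: ltW.
    + move=> B hB; exists (iF *m B); first exact: isEmb_mul eF hB.
      by rewrite mulmx1 subrr; exact: opbnd0.
    + move=> T hT; exists (iG *m T); first exact: isEmb_mul eG hT.
      by rewrite mulmx1 subrr; exact: opbnd0.
    + by rewrite /e'; lra.
  - by rewrite !powR1 !mul1r.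
have [|p [q [hp hq [NH [hH eH rH]]]]] := ramsey_space (eps := eps) hF hG e0 e'0 (ltW e40)
    dn iF1 iFe iG1 iGe Lext ram.
  by rewrite /e'; lra.
exists (n + kF * p + kG * q)%N, NH; split=> //.
by apply: dim_bound => //; rewrite bE.
Qed.
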